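(* For every fixed constant $c$, \textsc{DTS} and \textsc{DTD} restricted to instances with $\delta_{\max}\le c$ admit a polynomial kernel when parameterized by $D_{\max}+|F|$.
   Context: A classification instance (CI) $E=E^+\cup E^-$ is a finite set of examples $e:F\to\mathbb{Z}$ over a common feature set $F$, partitioned into positive and negative examples. $\lambda(e,e')$ is the set of features on which $e,e'$ differ; $\delta_{\max}=\max_{e^+\in E^+,e^-\in E^-}|\lambda(e^+,e^-)|$; $D_{\max}=\max_{f\in F}|\{e(f):e\in E\}|$. A decision tree (DT) is a rooted tree whose test nodes $v$ carry a feature $f(v)$ and integer threshold $\lambda(v)$ (examples with $e(f(v))\le\lambda(v)$ go left, others right) and whose leaves are labeled positive or negative; $T$ classifies $E$ if every example reaches a leaf with its own label. Size = number of test nodes; depth = maximum number of test nodes on a root-to-leaf path. \textsc{DTS}: given $(E,s)$, is there a DT of size at most $s$ classifying $E$? \textsc{DTD}: given $(E,d)$, is there a DT of depth at most $d$ classifying $E$? A kernel is a polynomial-time algorithm mapping an instance with parameter $k$ to an equivalent instance of the same problem whose size is bounded by a function of $k$; it is polynomial if that function is a polynomial. *)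

(* Defs.v *)
From Stdlib Require Import BinNums BinPos BinNat.
From HB Require Import structures.
From mathcomp Require Import all_boot all_order all_algebra.
Set Implicit Arguments. Unset Strict Implicit. Unset Printing Implicit Defensive.
Import Order.TTheory GRing.Theory Num.Theory.

(* A CI has features F = {0,...,nfeat-1}; an example e : F -> Z is a     *)
(* list of nfeat integers, e(f) = nth 0 e f.  E^+ = pos, E^- = neg.        *)
Record CI := mkCI { nfeat : nat; pos : seq (seq int); neg : seq (seq int) }.

Definition exval (e : seq int) (f : nat) : int := nth 0%R e f.

Definition CI_wf (E : CI) : bool :=
  [&& all (fun e => size e == nfeat E) (pos E ++ neg E),
      uniq (pos E), uniq (neg E) &
      all (fun e => e \notin neg E) (pos E)].

Definition lambda (E : CI) (e e' : seq int) : seq nat :=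
  [seq f <- iota 0 (nfeat E) | exval e f != exval e' f].

Definition delta_max (E : CI) : nat :=
  \max_(ep <- pos E) \max_(en <- neg E) size (lambda E ep en).

Definition D_max (E : CI) : nat :=
  \max_(f < nfeat E) size (undup [seq exval e f | e <- pos E ++ neg E]).

Inductive DT := Leaf of bool | Node of nat & int & DT & DT.

Fixpoint dt_classify (T : DT) (e : seq int) : bool :=
  match T with
  | Leaf b => b
  | Node f t l r => if (exval e f <= t)%R then dt_classify l e else dt_classify r e
  end.

Fixpoint dt_features_ok (n : nat) (T : DT) : bool :=
  match T with
  | Leaf _ => true
  | Node f _ l r => [&& f < n, dt_features_ok n l & dt_features_ok n r]
  end.

Fixpoint dt_size (T : DT) : nat :=
  match T with Leaf _ => 0 | Node _ _ l r => (dt_size l + dt_size r).+1 end.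

Fixpoint dt_depth (T : DT) : nat :=
  match T with Leaf _ => 0 | Node _ _ l r => (maxn (dt_depth l) (dt_depth r)).+1 end.

Definition dt_classifies (T : DT) (E : CI) : bool :=
  dt_features_ok (nfeat E) T &&
  (all (fun e => dt_classify T e) (pos E) && all (fun e => ~~ dt_classify T e) (neg E)).

Record Inst := mkInst { inst_ci : CI; budget : nat }.

Definition DTS (I : Inst) : Prop :=
  exists T, dt_classifies T (inst_ci I) /\ dt_size T <= budget I.
Definition DTD (I : Inst) : Prop :=
  exists T, dt_classifies T (inst_ci I) /\ dt_depth T <= budget I.

Definition dom (c : nat) (I : Inst) : Prop :=
  CI_wf (inst_ci I) /\ delta_max (inst_ci I) <= c.

Definition kparam (I : Inst) : nat := D_max (inst_ci I) + nfeat (inst_ci I).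

(* Binary encoding of instances (prefix-free, values in binary)          *)
Fixpoint enc_pos (p : positive) : seq bool :=
  match p with
  | xH => [:: false]
  | xO p' => [:: true, false & enc_pos p']
  | xI p' => [:: true, true & enc_pos p']
  end.

Definition enc_N (n : N) : seq bool :=
  match n with N0 => [:: false] | Npos p => true :: enc_pos p end.

Definition enc_nat (n : nat) : seq bool := enc_N (N.of_nat n).

Definition enc_int (z : int) : seq bool :=
  match z with Posz n => false :: enc_nat n | Negz n => true :: enc_nat n end.

Fixpoint enc_list (T : Type) (enc : T -> seq bool) (s : seq T) : seq bool :=
  match s with [::] => [:: false] | x :: s' => true :: enc x ++ enc_list enc s' end.

Definition enc_inst (I : Inst) : seq bool :=
  enc_nat (nfeat (inst_ci I)) ++ enc_list (enc_list enc_int) (pos (inst_ci I))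
  ++ enc_list (enc_list enc_int) (neg (inst_ci I)) ++ enc_nat (budget I).

Inductive move := MLeft | MRight | MStay.
Definition sym := option bool.  (* None = blank *)

Record TM := mkTM {
  tm_q : nat;                                   (* states 'I_(tm_q.+1), start = ord0 *)
  tm_delta : 'I_tm_q.+1 -> sym -> 'I_tm_q.+1 * sym * move;
  tm_halt : 'I_tm_q.+1 -> bool }.

(* configuration: state, cells left of head (nearest first), head cell and right *)
Definition config (M : TM) := ('I_(tm_q M).+1 * seq sym * seq sym)%type.

Definition tm_step (M : TM) (cf : config M) : config M :=
  let: (st, l, r) := cf in
  if tm_halt st then cf else
  let: (st', w, m) := tm_delta st (head None r) in
  match m with
  | MStay => (st', l, w :: behead r)
  | MRight => (st', w :: l, behead r)
  | MLeft => (st', behead l, head None l :: w :: behead r)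
  end.

Definition tm_init (M : TM) (x : seq bool) : config M := (ord0, [::], map Some x).
Arguments tm_init : clear implicits.

Fixpoint tape_out (s : seq sym) : seq bool :=
  match s with Some b :: s' => b :: tape_out s' | _ => [::] end.

(* M on input x has halted after t steps, with output y
   (the maximal blank-free word starting at the head) *)
Definition tm_computes_within (M : TM) (x y : seq bool) (t : nat) : Prop :=
  let: (st, _, r) := iter t (@tm_step M) (tm_init M x) in
  tm_halt st /\ tape_out r = y.

Definition poly_kernel (L : Inst -> Prop) (Dom : Inst -> Prop) (kappa : Inst -> nat) : Prop :=
  exists (M : TM) (a b cq dq : nat),
    forall I, Dom I ->
      exists I', [/\ Dom I', (L I <-> L I'),
                   size (enc_inst I') <= cq * (kappa I).+1 ^ dq &
                   tm_computes_within M (enc_inst I) (enc_inst I')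
                     (a * (size (enc_inst I)).+1 ^ b)].

(* Main.v *)
From Stdlib Require Import BinNums BinPos BinNat.
Require Import Defs.
From mathcomp Require Import all_boot all_order all_algebra zify ring.
Set Implicit Arguments. Unset Strict Implicit. Unset Printing Implicit Defensive.
Import Order.TTheory GRing.Theory Num.Theory.

(* If one of the two classes is empty, the instance is a yes-instance.
   Otherwise every example differs from a fixed example of the other class in
   at most c features, so there are at most 2 (|F| D_max + 1)^c examples, and
   only the numbers have to be shortened.  The value e(f) is replaced by 2^r,
   where r is the number of examples with a smaller value of f; as this
   respects the order of the values of each feature, decision trees carry over
   in both directions by adapting their thresholds.  The budget loses all its
   binary digits beyond the number m of examples (its leading digit excepted):
   this matters only if both budgets are at least m, and then both instances
   are yes-instances since some tree with fewer than m tests separates the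
   examples.

   The map is computed by a program for an automaton with seven two-way
   read-only heads and a write-only output.  Such a program runs in polynomial
   time as soon as it terminates, because no configuration can repeat.  Each
   head is represented by the pair of stacks of the bits on its two sides, and
   the Turing machine interleaves these stacks on the left half of its tape,
   the right half being the stack that holds first the input and then the
   output. *)

(** * Turing machines with long moves *)

(** The powers of two stand in for the ranks because numbers are encoded with the least significant
    digit first: 2^r is written by emitting one zero digit for each example with a smaller value and
    then the leading 1. Hence the program needs no counter for the rank and no conversion to binary,
    and repeated values need not be recognized. The price is an encoding of length linear, instead
    of logarithmic, in the number of examples, which is still polynomial in the parameter. The
    budget is likewise shortened by copying at most one digit per example instead of computing a
    minimum.

    The machine model has one tape and the three symbols 0, 1 and blank, so there is no room for
    marks on the tape. The layout of the stacks is chosen so that blanks alone delimit them, and the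
    head returns to cell 0 after each stack instruction.

    Since the time bound comes from counting configurations, the semantics of programs carries no
    cost: it suffices to exhibit one terminating run. This forces the number of heads to be fixed
    and the output to be kept out of the configurations that are counted. *)

Definition tape := int -> sym.

Definition upd_tape (t : tape) (h : int) (w : sym) : tape :=
  fun z => if z == h then w else t z.

(** The default [None] is the blank, so configurations that differ only in trailing blanks represent
    the same tape. *)
Definition reps (l r : seq sym) (h : int) (t : tape) : Prop :=
  (forall j : nat, nth None r j = t (h + j%:Z)%R) /\
  (forall j : nat, nth None l j = t (h - 1 - j%:Z)%R).

Lemma reps_eq l r h t t' : t =1 t' -> reps l r h t -> reps l r h t'.
Proof. by move=> e [H1 H2]; split=> j; rewrite -e. Qed.

Lemma reps_head l r h t : reps l r h t -> head None r = t h.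
Proof. by case=> /(_ 0); rewrite nth0 addr0. Qed.

Lemma reps_stay l r h t w : reps l r h t -> reps l (w :: behead r) h (upd_tape t h w).
Proof.
case=> Hr Hl; split=> j; rewrite /upd_tape.
  case: j => [|j]; first by rewrite addr0 eqxx.
  rewrite -[LHS]/(nth None (behead r) j) nth_behead Hr.
  by case: eqP => // ?; lia.
by rewrite Hl; case: eqP => // ?; lia.
Qed.

Lemma reps_right l r h t :
  reps l r h t -> reps (head None r :: l) (behead r) (h + 1)%R t.
Proof.
case=> Hr Hl; split=> j; first by rewrite nth_behead Hr; congr t; lia.
case: j => [|j] /=; first by rewrite -nth0 Hr; congr t; lia.
by rewrite Hl; congr t; lia.
Qed.

Lemma reps_left l r h t :
  reps l r h t -> reps (behead l) (head None l :: r) (h - 1)%R t.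
Proof.
case=> Hr Hl; split=> j; last by rewrite nth_behead Hl; congr t; lia.
case: j => [|j] /=; first by rewrite -nth0 Hl; congr t; lia.
by rewrite Hr; congr t; lia.
Qed.

Lemma tape_out_eq r y :
  (forall j, nth None r j = nth None (map Some y) j) -> tape_out r = y.
Proof.
elim: y r => [|b y IH] [|a r] //= H.
- by move: (H 0) => /= ->.
- by have := H 0.
- by have /= -> := H 0; rewrite IH // => j; have := H j.+1.
Qed.

Lemma iter_fix (T : Type) (f : T -> T) n x : f x = x -> iter n f x = x.
Proof. by move=> e; elim: n => //= n ->. Qed.

(* A machine whose transitions may move the head by any displacement of
   absolute value at most W; a counter in the state spells such a move out
   in unit steps. *)
Section JumpMachine.
Variables (Q : finType) (q0 : Q) (d : Q -> sym -> Q * sym * int) (hlt : Q -> bool).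
Variable W : nat.
Hypothesis dW : forall q a, `|(d q a).2|%N <= W.

Let X : finType := (Q * 'I_W.+1 * bool)%type.
Let x0 : X := (q0, ord0, false).
(** The start state is put first to get index 0, where every [TM] starts; its second occurrence in
    [enum X] accounts for the extra state. *)
Let xs : seq X := x0 :: enum X.

Definition jm_enc (x : X) : 'I_#|X|.+1 := inord (index x xs).
Definition jm_dec (i : 'I_#|X|.+1) : X := nth x0 xs i.

Lemma jm_encK : cancel jm_enc jm_dec.
Proof.
move=> x; have lt : index x xs < #|X|.+1.
  by rewrite [X in _ < X](_ : _ = size xs) ?index_mem ?inE ?mem_enum ?orbT //= cardE.
by rewrite /jm_dec /jm_enc inordK // nth_index // inE mem_enum orbT.
Qed.

Lemma jm_enc0 : jm_enc x0 = ord0.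
Proof. by apply: val_inj; rewrite /jm_enc /= eqxx inordK. Qed.

(** The counter [m] holds the unit steps still to be made in direction [dir]. The transition that
    writes already makes one of them, so displacements [Posz k.+1] and [Negz k] both leave [k]. *)
Definition jm_delta (x : X) (a : sym) : X * sym * move :=
  let: (q, m, dir) := x in
  if m == ord0 then
    let: (q', w, z) := d q a in
    match z with
    | Posz 0 => (q', ord0, false, w, MStay)
    | Posz k.+1 => (q', inord k, true, w, MRight)
    | Negz k => (q', inord k, false, w, MLeft)
    end
  else (q, inord m.-1, dir, a, if dir then MRight else MLeft).

Definition jm_TM : TM :=
  @mkTM #|X|
    (fun i a => let: (x, w, m) := jm_delta (jm_dec i) a in (jm_enc x, w, m))
    (fun i => let: (q, m, _) := jm_dec i in (m == ord0) && hlt q).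

Definition jm_cf (q : Q) (m : nat) (dir : bool) l r : config jm_TM :=
  (jm_enc (q, inord m, dir), l, r).

Lemma jm_cf_init x : tm_init jm_TM x = jm_cf q0 0 false [::] (map Some x).
Proof.
rewrite /tm_init /jm_cf; congr (_, _, _).
by rewrite -jm_enc0 /x0 /=; congr (jm_enc (_, _, _)); apply: val_inj; rewrite /= inordK.
Qed.

Lemma jm_halted q dir l r k : hlt q ->
  iter k (@tm_step jm_TM) (jm_cf q 0 dir l r) = jm_cf q 0 dir l r.
Proof.
move=> hq; apply: iter_fix; rewrite /tm_step /jm_cf /= jm_encK.
suff -> : (inord 0 : 'I_W.+1) == ord0 by rewrite hq.
by rewrite -val_eqE /= inordK.
Qed.

Lemma jm_move q dir m l r h t : m <= W -> reps l r h t ->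
  exists l' r', iter m (@tm_step jm_TM) (jm_cf q m dir l r) = jm_cf q 0 dir l' r' /\
    reps l' r' (if dir then h + m%:Z else h - m%:Z)%R t.
Proof.
elim: m l r h => [|m IH] l r h le_m rp.
  by exists l, r; split=> //; case: dir; rewrite ?addr0 ?subr0.
have m1 : ((inord m.+1 : 'I_W.+1) == ord0) = false by rewrite -val_eqE /= inordK.
have st : tm_step (jm_cf q m.+1 dir l r) =
    if dir then jm_cf q m dir (t h :: l) (behead r)
    else jm_cf q m dir (behead l) (head None l :: t h :: behead r).
  rewrite /jm_cf /tm_step /= jm_encK m1 /= m1 inordK //= (reps_head rp).
  by case: dir IH.
have rp1 : reps l (t h :: behead r) h t.
  by apply: reps_eq (reps_stay (t h) rp) => z; rewrite /upd_tape; case: eqP => // ->.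
rewrite iterSr st; case: dir IH {st} => IH.
  case: (IH _ _ _ (ltnW le_m) (reps_right rp1)) => l' [r' [e rp']].
  exists l', r'; split; first exact: e.
  by rewrite -[m.+1]add1n PoszD addrA.
case: (IH _ _ _ (ltnW le_m) (reps_left rp1)) => l' [r' [e rp']].
exists l', r'; split; first exact: e.
by rewrite -[m.+1]add1n PoszD opprD addrA.
Qed.

(** [K] bounds the unit steps. Quantifying over [dir], [l] and [r] makes the relation compose: the
    direction bit is a leftover of the previous move, and the lists matter only through the tape
    that they represent. *)
Definition reach (K : nat) q h t q' h' t' : Prop :=
  forall dir l r, reps l r h t ->
  exists k dir' l' r', [/\ k <= K,
    iter k (@tm_step jm_TM) (jm_cf q 0 dir l r) = jm_cf q' 0 dir' l' r' & reps l' r' h' t'].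

Lemma reach_refl q h t : reach 0 q h t q h t.
Proof. by move=> dir l r rp; exists 0, dir, l, r. Qed.

Lemma reach_trans q2 h2 t2 K1 K2 q1 h1 t1 q3 h3 t3 :
  reach K1 q1 h1 t1 q2 h2 t2 -> reach K2 q2 h2 t2 q3 h3 t3 ->
  reach (K1 + K2) q1 h1 t1 q3 h3 t3.
Proof.
move=> R1 R2 dir l r /(R1 dir)[k1 [dir1 [l1 [r1 [le1 e1 rp1]]]]].
case: (R2 dir1 _ _ rp1) => k2 [dir2 [l2 [r2 [le2 e2 rp2]]]].
exists (k2 + k1), dir2, l2, r2; split=> //; first by rewrite addnC leq_add.
by rewrite iterD e1.
Qed.

Lemma reach_eq K q h t q' h' t' t'' :
  t' =1 t'' -> reach K q h t q' h' t' -> reach K q h t q' h' t''.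
Proof.
move=> e R dir l r /(R dir)[k [dir' [l' [r' [? ? ?]]]]].
by exists k, dir', l', r'; split=> //; apply: reps_eq e _.
Qed.

Lemma reach_le K K' q h t q' h' t' :
  K <= K' -> reach K q h t q' h' t' -> reach K' q h t q' h' t'.
Proof.
move=> le R dir l r /(R dir)[k [dir' [l' [r' [? ? ?]]]]].
by exists k, dir', l', r'; split=> //; apply: leq_trans le.
Qed.

Lemma reach_step q h t q' w z : ~~ hlt q -> d q (t h) = (q', w, z) ->
  reach W.+1 q h t q' (h + z)%R (upd_tape t h w).
Proof.
move=> nh e dir l r rp.
have m0 : (inord 0 : 'I_W.+1) == ord0 by rewrite -val_eqE /= inordK.
have i0 : (inord 0 : 'I_W.+1) = ord0 by apply/eqP.
have rp1 := reps_stay w rp.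
have := dW q (t h); rewrite e /= => le.
have st : iter 1 (@tm_step jm_TM) (jm_cf q 0 dir l r) =
   match z with
    | Posz 0 => jm_cf q' 0 false l (w :: behead r)
    | Posz k.+1 => jm_cf q' k true (w :: l) (behead r)
    | Negz k => jm_cf q' k false (behead l) (head None l :: w :: behead r)
    end.
  rewrite /= /jm_cf /tm_step /= jm_encK m0 (negbTE nh) /= m0 (reps_head rp) e.
  by case: (z) => [[|k]|k]; rewrite ?i0.
case: z e le st => [[|k]|k] e le st.
- by exists 1, false, l, (w :: behead r); split=> //; rewrite addr0.
- have [|l' [r' [e' rp']]] := @jm_move q' true k _ _ _ _ _ (reps_right rp1).
    exact: ltnW.
  exists (k + 1), true, l', r'; split; first by rewrite addn1 ltnS ltnW.
    by rewrite iterD st e'.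
  by move: rp'; rewrite -[k.+1]add1n PoszD addrA.
- have [|l' [r' [e' rp']]] := @jm_move q' false k _ _ _ _ _ (reps_left rp1).
    exact: ltnW.
  exists (k + 1), false, l', r'; split; first by rewrite addn1 ltnS ltnW.
    by rewrite iterD st e'.
  by move: rp'; rewrite NegzE -[k.+1]add1n PoszD opprD addrA.
Qed.

End JumpMachine.

(** * Stack machines *)

(* SMv j j' n0 n1 nE moves the top bit b of stack j to stack j' and jumps to
   n0 or n1 according to b; it jumps to nE if stack j is empty. *)
Inductive sinstr :=
  | SMv of nat & nat & nat & nat & nat
  | SPush of nat & bool & nat.

Definition stacks := nat -> seq bool.

Definition upd (S : stacks) (j : nat) (v : seq bool) : stacks :=
  fun i => if i == j then v else S i.

Definition sinstr_step (i : sinstr) (S : stacks) : nat * stacks :=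
  match i with
  | SMv j j' n0 n1 nE =>
    if S j is b :: r then
      (if b then n1 else n0, let S1 := upd S j r in upd S1 j' (b :: S1 j'))
    else (nE, S)
  | SPush j b n => (n, upd S j (b :: S j))
  end.

Definition snop := SPush 0 false 0.

Section StackMachine.
Variables (code : seq sinstr) (pc0 hpc K : nat).

Definition sstep (c : nat * stacks) : nat * stacks :=
  if c.1 == hpc then c else sinstr_step (nth snop code c.1) c.2.

Definition sinstr_ok (i : sinstr) : bool :=
  match i with
  | SMv j j' n0 n1 nE =>
    [&& j <= K, j' <= K, n0 < size code, n1 < size code & nE < size code]
  | SPush j b n => (j <= K) && (n < size code)
  end.

Hypothesis K_gt0 : 0 < K.
Hypothesis code_ok : all sinstr_ok code.
Hypothesis pc0_lt : pc0 < size code.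

(* The element of height m of stack j (the bottom has height 1) is stored at
   cell j m; the cell cell j 0 is always blank. *)
Definition cell_base (j : nat) : int := if j == 0 then (-1)%R else (- j%:Z)%R.
Definition stride (j : nat) : int := if j == 0 then 1%R else (- K%:Z)%R.
Definition cell (j m : nat) : int := (cell_base j + stride j * m%:Z)%R.

Lemma cellS j m : cell j m.+1 = (cell j m + stride j)%R.
Proof. by rewrite /cell -addn1 PoszD mulrDr mulr1 addrA. Qed.

Lemma cellSB j m : (cell j m.+1 - stride j)%R = cell j m.
Proof. by rewrite cellS addrK. Qed.

(** Stacks 0 and 1 share cell -1 as their guard, so only positive heights can be told apart. Stack 0
    lies on the nonnegative side; for the others, the number j - 1 + K m determines m and j by
    division by K. *)
Lemma cell_inj j m j' m' : j <= K -> j' <= K ->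
  cell j m.+1 = cell j' m'.+1 -> j = j' /\ m = m'.
Proof.
rewrite /cell /cell_base /stride => lj lj'.
case: (eqVneq j 0) => [->|nj]; case: (eqVneq j' 0) => [->|nj'] => e.
- by split=> //; lia.
- by have : (K%:Z * m'.+1%:Z >= 0)%R by []; lia.
- by have : (K%:Z * m.+1%:Z >= 0)%R by []; lia.
have {}e : j + K * m.+1 = j' + K * m'.+1 by lia.
have em : m = m'.
  have E a b : 0 < a -> a <= K -> (a.-1 + K * b) %/ K = b.
    by move=> *; rewrite addnC mulnC divnMDl // divn_small ?addn0 //; lia.
  have E1 : (j.-1 + K * m.+1) %/ K = m.+1 by apply: E => //; lia.
  have E2 : (j'.-1 + K * m'.+1) %/ K = m'.+1 by apply: E => //; lia.
  have ee : j.-1 + K * m.+1 = j'.-1 + K * m'.+1 by lia.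
  by rewrite ee E2 in E1; case: E1.
by split=> //; move: e; rewrite em => e; lia.
Qed.

Lemma cell_guard j m j' : j <= K -> j' <= K -> cell j m.+1 <> cell j' 0.
Proof.
rewrite /cell /cell_base /stride => lj lj'.
have h : (K%:Z * m.+1%:Z >= K%:Z)%R by rewrite -PoszM lez_nat leq_pmulr.
by case: (eqVneq j 0) => [_|nj]; case: (eqVneq j' 0) => [_|nj'] => e; lia.
Qed.

(** The leading blank is the guard that tells a descending head that it has passed the bottom. *)
Definition track (s : seq bool) : seq sym := None :: map Some (rev s).

Definition tape_rel (S : stacks) (t : tape) : Prop :=
  forall j, j <= K -> forall m, t (cell j m) = nth None (track (S j)) m.

Lemma size_track s : size (track s) = (size s).+1.
Proof. by rewrite /= size_map size_rev. Qed.

Lemma track_blank s m : size s < m -> nth None (track s) m = None.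
Proof. by move=> lt; rewrite nth_default // size_track. Qed.

Lemma track_full s m : 0 < m <= size s -> exists b, nth None (track s) m = Some b.
Proof.
case: m => //= m; rewrite -size_rev => lt.
by exists (nth false (rev s) m); rewrite (nth_map false).
Qed.

Lemma track_top b s : nth None (track (b :: s)) (size s).+1 = Some b.
Proof. by rewrite /track /= rev_cons map_rcons nth_rcons size_map size_rev ltnn eqxx. Qed.

Lemma track_push b s m :
  nth None (track (b :: s)) m = if m == (size s).+1 then Some b else nth None (track s) m.
Proof.
case: m => [|m] //; rewrite /track /= rev_cons map_rcons nth_rcons size_map size_rev eqSS.
by case: ltngtP => // lt; rewrite nth_default // size_map size_rev ltnW.
Qed.

Lemma tape_rel_push S t j b : j <= K -> tape_rel S t ->
  tape_rel (upd S j (b :: S j)) (upd_tape t (cell j (size (S j)).+1) (Some b)).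
Proof.
move=> lj R i li m; rewrite /upd_tape /upd.
case: (eqVneq i j) => [->|ne].
  rewrite track_push; case: eqP => [e|ne].
    case: m e => [e|m /cell_inj[] // _ ->]; last by rewrite eqxx.
    by case: (cell_guard lj lj (esym e)).
  by rewrite R //; case: eqP => // em; case: ne; rewrite em.
rewrite R //; case: eqP => // e; case: m e => [e|m /cell_inj[] // e].
  by case: (cell_guard lj li (esym e)).
by rewrite e eqxx in ne.
Qed.

Lemma tape_rel_pop S t j b s : j <= K -> S j = b :: s -> tape_rel S t ->
  tape_rel (upd S j s) (upd_tape t (cell j (size s).+1) None).
Proof.
move=> lj Sj R i li m; rewrite /upd_tape /upd.
case: (eqVneq i j) => [->|ne].
  have := R j lj m; rewrite Sj track_push => ->.
  case: eqP => [e|ne].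
    case: m e => [e|m /cell_inj[] // _ ->]; last by rewrite track_blank.
    by case: (cell_guard lj lj (esym e)).
  by case: eqP => // em; case: ne; rewrite em.
rewrite R //; case: eqP => // e; case: m e => [e|m /cell_inj[] // e].
  by case: (cell_guard lj li (esym e)).
by rewrite e eqxx in ne.
Qed.

Let Q : finType := ('I_(size code) * 'I_6 * bool)%type.

Lemma code_gt0 : 0 < size code. Proof. exact: leq_ltn_trans pc0_lt. Qed.

Definition sm_st (pc ph : nat) (b : bool) : Q :=
  (insubd (Ordinal code_gt0) pc, inord ph, b).

Definition dest (i : sinstr) := match i with SMv _ j' _ _ _ => j' | SPush j _ _ => j end.
Definition next (i : sinstr) (b : bool) :=
  match i with SMv _ _ n0 n1 _ => if b then n1 else n0 | SPush _ _ n => n end.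

(* Phases: 0 leave cell 0; 1, 2 climb stack j and pop; 3 descend;
   4 climb the destination stack and push; 5 descend and return to cell 0. *)
Definition sm_delta (q : Q) (a : sym) : Q * sym * int :=
  let: (pc, ph, b) := q in
  let i := nth snop code pc in
  match i, val ph with
  | SPush j b' _, 0 => (sm_st pc 4 b', a, cell_base j + stride j)%R
  | SMv j _ _ _ _, 0 => (sm_st pc 1 false, a, cell_base j + stride j)%R
  | SMv j _ _ _ _, 1 =>
    if a is None then (sm_st pc 2 false, a, - stride j)%R
    else (sm_st pc 1 false, a, stride j)
  | SMv j _ _ _ nE, 2 =>
    if a is Some b' then (sm_st pc 3 b', None, - stride j)%R
    else (sm_st nE 0 false, a, - cell_base j)%R
  | SMv j j' _ _ _, 3 =>
    if a is None then (sm_st pc 4 b, a, - cell_base j + (cell_base j' + stride j'))%R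
    else (sm_st pc 3 b, a, - stride j)%R
  | _, 4 =>
    if a is None then (sm_st pc 5 b, Some b, - stride (dest i))%R
    else (sm_st pc 4 b, a, stride (dest i))
  | _, 5 =>
    if a is None then (sm_st (next i b) 0 false, a, - cell_base (dest i))%R
    else (sm_st pc 5 b, a, - stride (dest i))%R
  | _, _ => (q, a, 0%R)
  end.

Definition sm_halt (q : Q) : bool :=
  let: (pc, ph, b) := q in (val ph == 0) && (val pc == hpc).

(** The longest move, from the guard of one stack to the bottom of another, has length at most 3
    K. *)
Definition sm_W := 4 * K + 4.

Lemma cell_base_le j : j <= K -> `|cell_base j|%N <= K.
Proof. by rewrite /cell_base; case: eqP => _ lj; lia. Qed.

Lemma stride_le j : `|stride j|%N <= K.
Proof. by rewrite /stride; case: eqP => _; lia. Qed.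

Lemma nth_code_ok pc : pc < size code -> sinstr_ok (nth snop code pc).
Proof. by move=> lt; apply: (all_nthP _ code_ok). Qed.

Lemma sm_deltaW q a : `|(sm_delta q a).2|%N <= sm_W.
Proof.
case: q => [[pc ph] b]; have := nth_code_ok (ltn_ord pc).
rewrite /sm_delta /sm_W; case: (nth _ _ _) => [j j' n0 n1 nE|j b' n] /=.
  case/and5P=> lj lj' _ _ _.
  have := cell_base_le lj; have := cell_base_le lj'; have := stride_le j; have := stride_le j'.
  by case: (val ph) => [|[|[|[|[|[|m]]]]]]; case: a => [?|] /=; lia.
case/andP=> lj _; have := cell_base_le lj; have := stride_le j.
by case: (val ph) => [|[|[|[|[|[|m]]]]]]; case: a => [?|] /=; lia.
Qed.

Definition sm_TM := jm_TM (sm_st pc0 0 false) sm_delta sm_halt sm_W.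

Local Notation reach := (@reach Q (sm_st pc0 0 false) sm_delta sm_halt sm_W).

Lemma sm_reach pc ph b h t q' w z : pc < size code -> ph < 6 ->
  (ph != 0) || (pc != hpc) ->
  sm_delta (sm_st pc ph b) (t h) = (q', w, z) ->
  reach sm_W.+1 (sm_st pc ph b) h t q' (h + z)%R (upd_tape t h w).
Proof.
move=> lt lph nh; apply: reach_step; first exact: sm_deltaW.
by rewrite /sm_st /sm_halt /= inordK // insubdK // negb_and.
Qed.

Lemma upd_tape_id t h : upd_tape t h (t h) =1 t.
Proof. by move=> z; rewrite /upd_tape; case: eqP => // ->. Qed.

Lemma sm_reach_same pc ph b h t q' z h' : pc < size code -> ph < 6 ->
  (ph != 0) || (pc != hpc) ->
  sm_delta (sm_st pc ph b) (t h) = (q', t h, z) -> (h + z)%R = h' ->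
  reach sm_W.+1 (sm_st pc ph b) h t q' h' t.
Proof.
by move=> lt lph nh e <-; apply: reach_eq (@upd_tape_id t h) _; apply: sm_reach.
Qed.

Lemma sm_scan pc ph b t (f : nat -> int) z n :
  pc < size code -> ph < 6 -> ph != 0 ->
  (forall m, m < n -> exists a, t (f m) = Some a) ->
  (forall m, f m.+1 = f m + z)%R ->
  (forall a, sm_delta (sm_st pc ph b) (Some a) = (sm_st pc ph b, Some a, z)) ->
  reach (n * sm_W.+1) (sm_st pc ph b) (f 0) t (sm_st pc ph b) (f n) t.
Proof.
move=> lt lph nph full fS step; elim: n full => [|n IH] full; first exact: reach_refl.
rewrite mulSn addnC; apply: reach_trans (IH _) _; first by move=> m lm; apply: full; apply: ltnW.
have [a ta] := full n (ltnSn n).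
by apply: (@sm_reach_same _ _ _ _ _ _ z); rewrite ?nph ?ta ?fS.
Qed.

Section Scans.
Variables (pc ph j : nat) (b : bool) (S : stacks) (t : tape).
Hypotheses (pc_lt : pc < size code) (ph_lt : ph < 6) (ph_nz : ph != 0).
Hypotheses (le_jK : j <= K) (R : tape_rel S t).

Lemma sm_climb :
  (forall a, sm_delta (sm_st pc ph b) (Some a) = (sm_st pc ph b, Some a, stride j)) ->
  reach (size (S j) * sm_W.+1) (sm_st pc ph b) (cell j 1) t
        (sm_st pc ph b) (cell j (size (S j)).+1) t.
Proof.
move=> step; apply: (@sm_scan _ _ _ _ (fun m => cell j m.+1)) step => //.
  by move=> m lm; rewrite R //; apply: track_full.
by move=> m; rewrite cellS.
Qed.

Lemma sm_descend m : m <= size (S j) ->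
  (forall a, sm_delta (sm_st pc ph b) (Some a) = (sm_st pc ph b, Some a, - stride j)%R) ->
  reach (m * sm_W.+1) (sm_st pc ph b) (cell j m) t (sm_st pc ph b) (cell j 0) t.
Proof.
move=> lm step.
have := @sm_scan pc ph b t (fun i => cell j m - stride j * i%:Z)%R (- stride j)%R m
  pc_lt ph_lt ph_nz _ _ step.
have -> : (cell j m - stride j * m%:Z)%R = cell j 0 by rewrite /cell mulr0 addr0 addrK.
rewrite mulr0 subr0; apply; last by move=> i; lia.
move=> i li; have -> : (cell j m - stride j * i%:Z)%R = cell j (m - i) by rewrite /cell; lia.
by rewrite R //; apply: track_full; lia.
Qed.

End Scans.

Lemma val_sm_st pc ph b : pc < size code -> ph < 6 ->
  val (sm_st pc ph b).1.1 = pc /\ val (sm_st pc ph b).1.2 = ph.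
Proof. by move=> lt lph; rewrite /sm_st /= insubdK // inordK. Qed.

Lemma sm_deltaE pc ph b a : pc < size code -> ph < 6 ->
  sm_delta (sm_st pc ph b) a =
  let i := nth snop code pc in
  match i, ph with
  | SPush j b' _, 0 => (sm_st pc 4 b', a, cell_base j + stride j)%R
  | SMv j _ _ _ _, 0 => (sm_st pc 1 false, a, cell_base j + stride j)%R
  | SMv j _ _ _ _, 1 =>
    if a is None then (sm_st pc 2 false, a, - stride j)%R
    else (sm_st pc 1 false, a, stride j)
  | SMv j _ _ _ nE, 2 =>
    if a is Some b' then (sm_st pc 3 b', None, - stride j)%R
    else (sm_st nE 0 false, a, - cell_base j)%R
  | SMv j j' _ _ _, 3 =>
    if a is None then (sm_st pc 4 b, a, - cell_base j + (cell_base j' + stride j'))%R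
    else (sm_st pc 3 b, a, - stride j)%R
  | _, 4 =>
    if a is None then (sm_st pc 5 b, Some b, - stride (dest i))%R
    else (sm_st pc 4 b, a, stride (dest i))
  | _, 5 =>
    if a is None then (sm_st (next i b) 0 false, a, - cell_base (dest i))%R
    else (sm_st pc 5 b, a, - stride (dest i))%R
  | _, _ => (sm_st pc ph b, a, 0%R)
  end.
Proof.
move=> lt lph; have [e1 e2] := val_sm_st b lt lph.
by move: e1 e2; rewrite /sm_st /= => -> ->.
Qed.

(** Phases 4 and 5, shared by pushes and by the second half of a transfer: two scans of the stack,
    the writing move and the return to cell 0. *)
Lemma sm_push_phase pc b S t : pc < size code ->
  let i := nth snop code pc in let j := dest i in
  tape_rel S t ->
  exists t', tape_rel (upd S j (b :: S j)) t' /\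
   reach ((2 * size (S j) + 2) * sm_W.+1) (sm_st pc 4 b) (cell j 1) t
         (sm_st (next i b) 0 false) 0%R t'.
Proof.
move=> lt i j R.
have lj : j <= K.
  have := nth_code_ok lt; rewrite /j /dest -/i.
  by case: (i) => [????? /and5P[]|??? /andP[]].
pose t' := upd_tape t (cell j (size (S j)).+1) (Some b).
have R' : tape_rel (upd S j (b :: S j)) t' := tape_rel_push b lj R.
exists t'; split=> //.
have -> : (2 * size (S j) + 2) * sm_W.+1 =
  size (S j) * sm_W.+1 + (sm_W.+1 + (size (S j) * sm_W.+1 + sm_W.+1)) by lia.
apply: reach_trans (sm_climb _ _ _ _ R _) _ => //.
  by move=> a; rewrite sm_deltaE // /j /i; case: (nth snop code pc).
have top : t (cell j (size (S j)).+1) = None by rewrite R // track_blank.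
apply: reach_trans (sm_reach (q' := sm_st pc 5 b) (w := Some b) (z := - stride j)%R _ _ _ _) _ => //.
  by rewrite top sm_deltaE // /j /i; case: (nth snop code pc).
rewrite cellSB -/t'.
have H := @sm_descend pc 5 j b _ t' lt isT isT lj R' (size (S j)).
apply: reach_trans (H _ _) _.
- by rewrite /upd eqxx /=; lia.
- by move=> a; rewrite sm_deltaE // /j /i; case: (nth snop code pc).
have bot : t' (cell j 0) = None by rewrite R' // nth0.
apply: (@sm_reach_same _ _ _ _ _ _ (- cell_base j)%R) => //.
  by rewrite bot sm_deltaE // /j /i; case: (nth snop code pc).
by rewrite /cell mulr0 addr0 subrr.
Qed.

(** A transfer scans its source and its destination once upwards and once downwards, whence [4 * M];
    the 10 absorbs the moves between the scans. *)
Lemma sm_sim pc S t M : pc < size code -> pc != hpc -> tape_rel S t ->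
  (forall j, j <= K -> size (S j) <= M) ->
  exists t', tape_rel (sstep (pc, S)).2 t' /\
    reach ((4 * M + 10) * sm_W.+1) (sm_st pc 0 false) 0%R t
          (sm_st (sstep (pc, S)).1 0 false) 0%R t'.
Proof.
move=> lt nh R szM; rewrite /sstep /= (negbTE nh).
have ok := nth_code_ok lt.
case E: (nth snop code pc) ok => [j j' n0 n1 nE|j b n] /=; last first.
  case/andP=> lj _; have [t' [R' H]] := sm_push_phase b lt R.
  rewrite E /= in R' H; exists t'; split=> //.
  apply: (@reach_le _ _ _ _ _ (sm_W.+1 + (2 * size (S j) + 2) * sm_W.+1)).
    by rewrite -mulSn leq_mul2r /=; have := szM j lj; lia.
  apply: reach_trans H.
  apply: (@sm_reach_same _ _ _ _ _ _ (cell_base j + stride j)%R) => //.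
    by rewrite sm_deltaE //= E.
  by rewrite add0r cellS /cell mulr0 addr0.
case/and5P=> lj lj' _ _ _.
have step0 : reach sm_W.+1 (sm_st pc 0 false) 0%R t (sm_st pc 1 false) (cell j 1) t.
  apply: (@sm_reach_same _ _ _ _ _ _ (cell_base j + stride j)%R) => //.
    by rewrite sm_deltaE //= E.
  by rewrite add0r cellS /cell mulr0 addr0.
have climb : reach (size (S j) * sm_W.+1) (sm_st pc 1 false) (cell j 1) t
    (sm_st pc 1 false) (cell j (size (S j)).+1) t.
  by apply: sm_climb => //; move=> a; rewrite sm_deltaE //= E.
have top : t (cell j (size (S j)).+1) = None by rewrite R // track_blank.
have back : reach sm_W.+1 (sm_st pc 1 false) (cell j (size (S j)).+1) t
    (sm_st pc 2 false) (cell j (size (S j))) t.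
  apply: (@sm_reach_same _ _ _ _ _ _ (- stride j)%R) => //.
    by rewrite top sm_deltaE //= E.
  by rewrite cellS addrK.
have H := reach_trans step0 (reach_trans climb back).
have szj := szM j lj.
case Sj: (S j) H => [|b r] H /=.
  exists t; split=> //.
  apply: (@reach_le _ _ _ _ _ (sm_W.+1 + (0 * sm_W.+1 + sm_W.+1) + sm_W.+1)); first by lia.
  apply: reach_trans H _.
  have bot : t (cell j 0) = None by rewrite R // nth0.
  apply: (@sm_reach_same _ _ _ _ _ _ (- cell_base j)%R) => //.
    by rewrite bot sm_deltaE //= E.
  by rewrite /cell mulr0 addr0 subrr.
pose S1 := upd S j r; pose t1 := upd_tape t (cell j (size r).+1) None.
have R1 : tape_rel S1 t1 := tape_rel_pop lj Sj R.
have szj' : size (S1 j') <= M.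
  by rewrite /S1 /upd; case: eqP => _; rewrite ?szM //; move: szj; rewrite Sj /= => /ltnW.
have [t2 [R2 H2]] := sm_push_phase b lt R1.
rewrite E /= in R2 H2; exists t2; split=> //.
apply: (@reach_le _ _ _ _ _ (sm_W.+1 + ((size r).+1 * sm_W.+1 + sm_W.+1) +
   (sm_W.+1 + (size r * sm_W.+1 + (sm_W.+1 + (2 * size (S1 j') + 2) * sm_W.+1))))).
  have -> : forall w, w + ((size r).+1 * w + w) + (w + (size r * w + (w + (2 * size (S1 j') + 2) * w))) =
    (7 + 2 * size r + 2 * size (S1 j')) * w by lia.
  by rewrite leq_mul2r /=; rewrite Sj /= in szj; lia.
apply: reach_trans H _.
apply: reach_trans (sm_reach (q' := sm_st pc 3 b) (w := None) (z := - stride j)%R _ _ _ _) _ => //.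
  by have := R j lj (size r).+1; rewrite Sj track_top => ->; rewrite sm_deltaE //= E.
rewrite /= cellSB -/t1.
have D := @sm_descend pc 3 j b _ t1 lt isT isT lj R1 (size r).
apply: reach_trans (D _ _) _.
- by rewrite /S1 /upd eqxx.
- by move=> a; rewrite sm_deltaE //= E.
apply: reach_trans H2.
have bot : t1 (cell j 0) = None by rewrite R1 // nth0.
apply: (@sm_reach_same _ _ _ _ _ _ (- cell_base j + (cell_base j' + stride j'))%R) => //.
  by rewrite bot sm_deltaE //= E.
by rewrite cellS /cell !mulr0 !addr0 addNKr.
Qed.

Lemma sstep_size M S pc : (forall j, j <= K -> size (S j) <= M) ->
  forall j, j <= K -> size ((sstep (pc, S)).2 j) <= M.+1.
Proof.
move=> szM j lj; rewrite /sstep /=; case: ifP => _ /=; first by rewrite ltnW // ltnS szM.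
have szj i : i <= K -> size (S i) <= M.+1 by move=> li; rewrite ltnW // ltnS szM.
case: (nth _ _ _) => [i i' n0 n1 nE|i b n] /=; last first.
  by rewrite /upd; case: eqP => [<-|_] /=; rewrite ?ltnS ?szM // szj.
case Si: (S i) => [|b r] /=; first exact: szj.
rewrite /upd; case: (eqVneq j i') => [<-|_] /=.
  by case: (eqVneq j i) => [ji|_]; rewrite ltnS; have := szM j lj; rewrite ?ji ?Si //= => /ltnW.
by case: (eqVneq j i) => [ji|_]; have := szj j lj; rewrite ?ji ?Si //= => /ltnW.
Qed.

Lemma sstep_lt c : c.1 < size code -> (sstep c).1 < size code.
Proof.
move=> lt; rewrite /sstep; case: ifP => // _; have := nth_code_ok lt.
case: (nth _ _ _) => [j j' n0 n1 nE /and5P[_ _ l0 l1 l2]|j b n /andP[]] //=.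
by case: (c.2 j) => [|[] r].
Qed.

Lemma sm_run pc S t M k : pc < size code -> tape_rel S t ->
  (forall j, j <= K -> size (S j) <= M) ->
  let c := iter k sstep (pc, S) in
  exists t', [/\ tape_rel c.2 t', c.1 < size code &
    reach (k * ((4 * (M + k) + 10) * sm_W.+1)) (sm_st pc 0 false) 0%R t
          (sm_st c.1 0 false) 0%R t'].
Proof.
move=> lt R szM /=.
(* Stacks grow by at most one bit per step. The cost is stated for every k' >= k, so that the
   induction hypothesis already charges each step at the final height. *)
suff [t' [R' lt' _ H]] : exists t', [/\ tape_rel (iter k sstep (pc, S)).2 t',
    (iter k sstep (pc, S)).1 < size code,
    forall j, j <= K -> size ((iter k sstep (pc, S)).2 j) <= M + k &
    forall k', k <= k' -> reach (k * ((4 * (M + k') + 10) * sm_W.+1)) (sm_st pc 0 false) 0%R t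
          (sm_st (iter k sstep (pc, S)).1 0 false) 0%R t'].
  by exists t'; split=> //; apply: H.
elim: k => [|k [t1 [R1 lt1 sz1 H1]]].
  by exists t; split=> // [j|k' _]; [rewrite addn0; apply: szM | exact: reach_refl].
rewrite iterS; set c := iter k sstep (pc, S) in R1 lt1 sz1 H1 *.
have [ec|ne] := eqVneq c.1 hpc.
  have -> : sstep c = c by rewrite /sstep ec eqxx.
  exists t1; split=> // [j lj|k' lk]; first by rewrite addnS ltnW // ltnS sz1.
  by apply: reach_le (H1 _ (ltnW lk)); rewrite leq_mul2r leqnSn orbT.
case: c R1 lt1 sz1 H1 ne => [pc1 S1] /= R1 lt1 sz1 H1 ne.
have [t2 [R2 H2]] := sm_sim lt1 ne R1 sz1.
exists t2; split=> //.
- exact: (@sstep_lt (pc1, S1)).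
- by move=> j lj; rewrite addnS; apply: sstep_size sz1 _ lj.
move=> k' lk; rewrite mulSn addnC; apply: reach_trans (H1 _ (ltnW lk)) _.
by apply: reach_le H2; rewrite leq_mul2r /=; lia.
Qed.

(** The bottom of stack 0 is cell 0, where the head starts and stops. So the word on the tape is the
    stack read upwards, which is why both input and output appear reversed. *)
Lemma sm_correct x y k :
  let c := iter k sstep (pc0, fun j => if j == 0 then rev x else [::]) in
  c.1 = hpc -> c.2 0 = rev y ->
  forall T, k * ((4 * (size x + k) + 10) * sm_W.+1) <= T -> tm_computes_within sm_TM x y T.
Proof.
move=> c c1 c2 T leT.
pose S : stacks := fun j => if j == 0 then rev x else [::].
pose t : tape := fun z => if z is Posz m then nth None (map Some x) m else None.
have R : tape_rel S t.
  move=> j lj m; rewrite /S /t /cell /cell_base /stride; case: eqP => [_|nj].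
    rewrite /track revK mul1r; case: m => [|m] //.
    rewrite (_ : (-1 + m.+1%:Z)%R = m) //; lia.
  have : (K%:Z * m%:Z >= 0)%R by [].
  rewrite mulNr -opprD; case: j {lj} nj => // j _ H.
  have -> : (- (j.+1%:Z + K%:Z * m%:Z) = Negz (j + K * m))%R by lia.
  by case: m {H} => [|[|m]].
have sz j : j <= K -> size (S j) <= size x by rewrite /S; case: eqP => _; rewrite ?size_rev.
have [t' [R' lt' H]] := sm_run k pc0_lt R sz.
rewrite -/c c1 in R' lt' H.
have rp : reps [::] (map Some x) 0%R t.
  by split=> j; rewrite ?add0r // nth_nil -opprD.
have [k' [dir' [l' [r' [le_k e rp']]]]] := H false _ _ rp.
rewrite /tm_computes_within jm_cf_init -(subnK (leq_trans le_k leT)) iterD e jm_halted; last first.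
  by rewrite /sm_halt /sm_st /= inordK // insubdK //= eqxx.
rewrite /jm_cf; split.
  rewrite /= jm_encK /sm_halt /sm_st /= inordK // insubdK //= !eqxx andbT.
  by rewrite -val_eqE /= inordK.
apply: tape_out_eq => j; case: rp' => -> _; rewrite add0r.
have -> : Posz j = cell 0 j.+1 by rewrite /cell /cell_base /stride /= mul1r; lia.
by rewrite R' // c2 /track revK.
Qed.

End StackMachine.

(** * Multi-head automata *)

Section FirstHit.
Variables (T : eqType) (f : T -> T) (P : pred T) (x : T) (L : seq T).
Hypothesis orbit_sub : forall n, iter n f x \in L.

(** Before the first hit the orbit has no repetition, since otherwise it would cycle through points
    already visited; so these points are distinct members of [L]. *)
Lemma first_hit_bound : (exists n, P (iter n f x)) -> exists2 n, n <= size L & P (iter n f x).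
Proof.
move=> exec; case: (ex_minnP exec) => n Pn min_n; exists n => //.
rewrite -(size_traject f x n) uniq_leq_size //; last first.
  by move=> y /trajectP[i _ ->].
case: n Pn min_n => // n Pn min_n; rewrite looping_uniq.
apply/negP => /loopingP /(_ n.+1) /trajectP[i lt_in e].
by have := min_n i; rewrite -e Pn => /(_ isT); rewrite leqNgt ltnS ltnW.
Qed.

End FirstHit.

(* Programs for a two-way multi-head automaton with a write-only output:
   the heads read a fixed word x and also serve as counters up to size x. *)
Inductive pinstr :=
  | PR of nat & nat
  | PL of nat & nat
  | PBit of nat & nat & nat
  | PPos of nat & nat & nat
  | POut of bool & nat.

Definition pnop := POut false 0.

Definition heads := seq nat.
Definition hget (s : heads) i := nth 0 s i.
Definition hset (s : heads) i v : heads := set_nth 0 s i v.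

Definition nheads := 7.

Section Pointer.
Variable x : seq bool.

(** Heads are stopped at both ends, which keeps the configurations finite in number; at position
    [size x] the bit read is the default [false]. *)
Definition pexec (i : pinstr) (s : heads) : nat * heads :=
  match i with
  | PR i n => (n, if hget s i < size x then hset s i (hget s i).+1 else s)
  | PL i n => (n, hset s i (hget s i).-1)
  | PBit i nT nF => (if nth false x (hget s i) then nT else nF, s)
  | PPos i nT nF => (if 0 < hget s i then nT else nF, s)
  | POut b n => (n, s)
  end.

Definition pemit (i : pinstr) : seq bool := if i is POut b _ then [:: b] else [::].

Variable pcode : seq pinstr.
Let m := size pcode.

(** The step without its output. The output never influences the control, and without it only
    finitely many configurations remain. *)
Definition pstep (c : nat * heads) : nat * heads :=
  if c.1 == m then c else pexec (nth pnop pcode c.1) c.2.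

Definition fstep (c : nat * heads * seq bool) : nat * heads * seq bool :=
  if c.1.1 == m then c else
  (pexec (nth pnop pcode c.1.1) c.1.2, c.2 ++ pemit (nth pnop pcode c.1.1)).

Lemma fstep_fst n c o : (iter n fstep (c, o)).1 = iter n pstep c.
Proof.
elim: n => //= n; move: (iter n fstep _) => [c1 o1] /= ->.
by rewrite /fstep /pstep /=; case: ifP.
Qed.

Lemma fstep_halt n c : c.1.1 = m -> iter n fstep c = c.
Proof. by move=> e; apply: iter_fix; rewrite /fstep e eqxx. Qed.

Definition pinstr_ok (i : pinstr) : bool :=
  match i with
  | PR i n | PL i n => (i < nheads) && (n <= m)
  | PBit i n n' | PPos i n n' => [&& i < nheads, n <= m & n' <= m]
  | POut b n => n <= m
  end.

Hypothesis pcode_ok : all pinstr_ok pcode.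

Definition heads_ok (s : heads) := (size s == nheads) && all (fun p => p <= size x) s.

Lemma hset_ok s i v : heads_ok s -> i < nheads -> v <= size x -> heads_ok (hset s i v).
Proof.
case/andP=> /eqP sz al lt lv; apply/andP; split.
  by rewrite size_set_nth sz (maxn_idPr lt).
apply/(all_nthP 0) => j _; rewrite nth_set_nth /=; case: eqP => // _.
have [lj|lj] := ltnP j (size s); first exact: (all_nthP 0 al).
by rewrite nth_default.
Qed.

Lemma hget_le s i : heads_ok s -> hget s i <= size x.
Proof.
case/andP=> /eqP sz al; have [lj|lj] := ltnP i (size s); first exact: (all_nthP 0 al).
by rewrite /hget nth_default.
Qed.

Lemma pstep_ok c : c.1 <= m -> heads_ok c.2 -> (pstep c).1 <= m /\ heads_ok (pstep c).2.
Proof.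
rewrite /pstep; case: eqP => // /eqP ne le ok.
have lt : c.1 < m by rewrite ltn_neqAle ne.
have := all_nthP pnop pcode_ok _ lt.
have hl i := hget_le i ok.
case: (nth _ _ _) => [i n|i n|i n n'|i n n'|b n] /=.
- by case/andP=> li ln; split=> //; case: ifP => // lx; apply: hset_ok.
- by case/andP=> li ln; split=> //; apply: hset_ok => //; apply: leq_trans (leq_pred _) _.
- by case/and3P=> li ln ln'; split=> //; case: ifP.
- by case/and3P=> li ln ln'; split=> //; case: ifP.
- by [].
Qed.

Fixpoint all_heads (k : nat) : seq heads :=
  if k is k'.+1 then [seq p :: s | p <- iota 0 (size x).+1, s <- all_heads k'] else [:: [::]].

Lemma size_all_heads k : size (all_heads k) = (size x).+1 ^ k.
Proof.
elim: k => // k IH.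
rewrite -[LHS]/(size [seq p :: s | p <- iota 0 (size x).+1, s <- all_heads k]).
by rewrite size_allpairs size_iota IH expnS.
Qed.

Lemma mem_all_heads s : all (fun p => p <= size x) s -> s \in all_heads (size s).
Proof.
elim: s => // p s IH /andP[lp al].
rewrite -[all_heads _]/[seq p :: s | p <- iota 0 (size x).+1, s <- all_heads (size s)].
apply/allpairsP; exists (p, s); split; [by rewrite mem_iota | exact: IH | by []].
Qed.

Lemma pointer_halts_within n s0 : heads_ok s0 -> (iter n pstep (0, s0)).1 = m ->
  exists2 t, t <= m.+1 * (size x).+1 ^ nheads & (iter t pstep (0, s0)).1 = m.
Proof.
move=> ok0 e.
pose L := [seq (pc, s) | pc <- iota 0 m.+1, s <- all_heads nheads].
have inL t : iter t pstep (0, s0) \in L.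
  suff [lt /andP[/eqP sz al]] : (iter t pstep (0, s0)).1 <= m /\ heads_ok (iter t pstep (0, s0)).2.
    move: (iter t _ _) lt sz al => [pc s] /= lt sz al.
    apply/allpairsP; exists (pc, s); split=> //; first by rewrite mem_iota.
    by rewrite -sz mem_all_heads.
  by elim: t => [|t [l ok]] //=; apply: pstep_ok.
have [|t lt /eqP Pt] := @first_hit_bound _ pstep (fun c => c.1 == m) _ L inL.
  by exists n; apply/eqP.
by exists t => //; apply: leq_trans lt _; rewrite size_allpairs size_iota size_all_heads.
Qed.

(* Stacks 2i+1 and 2i+2 hold the bits to the left and to the right of head i,
   the nearest bit on top. *)
Definition to_s (i : pinstr) : sinstr :=
  match i with
  | PR i n => SMv (2 * i + 2) (2 * i + 1) n n n
  | PL i n => SMv (2 * i + 1) (2 * i + 2) n n n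
  | PBit i n n' => SMv (2 * i + 2) (2 * i + 2) n' n n'
  | PPos i n n' => SMv (2 * i + 1) (2 * i + 1) n n n'
  | POut b n => SPush 0 b n
  end.

Let B := m.+1.

(* Moves the input from stack 0 to the stacks 2i+2 of all seven heads. *)
Definition init_code : seq sinstr :=
  [:: SMv 0 2 (B + 1) (B + 7) 0;
      SPush 4 false (B + 2); SPush 6 false (B + 3); SPush 8 false (B + 4);
      SPush 10 false (B + 5); SPush 12 false (B + 6); SPush 14 false B;
      SPush 4 true (B + 8); SPush 6 true (B + 9); SPush 8 true (B + 10);
      SPush 10 true (B + 11); SPush 12 true (B + 12); SPush 14 true B].

(** Address [m] is the halting one and is merely filled by [snop]; the initialization therefore
    starts at [B], and on an empty stack 0 it jumps to address 0, the start of the program. *)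
Definition scode : seq sinstr := map to_s pcode ++ snop :: init_code.

Lemma size_scode : size scode = B + 13.
Proof. by rewrite size_cat size_map /= addnS. Qed.

Lemma scode_ok : all (sinstr_ok scode 14) scode.
Proof.
rewrite /scode all_cat; apply/andP; split.
  rewrite all_map; apply: sub_all pcode_ok => -[i n|i n|i n n'|i n n'|b n] /=;
  by rewrite /sinstr_ok size_scode /B /nheads /=; lia.
by rewrite /= /sinstr_ok size_scode /=; lia.
Qed.

Definition head_rel (S : stacks) (s : heads) (o : seq bool) : Prop :=
  S 0 = rev o /\ forall i, i < nheads ->
    S (2 * i + 1) = rev (take (hget s i) x) /\ S (2 * i + 2) = drop (hget s i) x.

Local Notation sstep := (sstep scode m).

Lemma hget_set s i v j : hget (hset s i v) j = if j == i then v else hget s j.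
Proof. by rewrite /hget nth_set_nth. Qed.

(** Each instruction becomes exactly one stack instruction. Moving a bit between the two stacks of a
    head moves the head; moving it back onto its own stack only tests it. *)
Lemma pointer_sim S c : c.1.1 <= m -> heads_ok c.1.2 -> head_rel S c.1.2 c.2 ->
  exists2 S', sstep (c.1.1, S) = ((fstep c).1.1, S') & head_rel S' (fstep c).1.2 (fstep c).2.
Proof.
case: c => [[pc s] o] /= le ok [R0 R].
rewrite /fstep /sstep /=; case: (eqVneq pc m) => [e|ne] /=; first by exists S.
have lt : pc < m by rewrite ltn_neqAle ne.
rewrite /scode nth_cat size_map lt (nth_map pnop) //.
have hl i := hget_le i ok.
have := all_nthP pnop pcode_ok _ lt.
case: (nth pnop pcode pc) => [i n|i n|i n n'|i n n'|b n] /=; rewrite ?cats0.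
- case/andP=> li _; have [R1 R2] := R i li; rewrite R2.
  have [lx|lx] := ltnP (hget s i) (size x); last by rewrite drop_oversize //; exists S.
  rewrite (drop_nth false lx); eexists; first by rewrite if_same.
  split; first by rewrite /upd !addn2 !addn1.
  move=> j lj; have [Rj1 Rj2] := R j lj; rewrite hget_set /upd.
  have [->|nij] := eqVneq j i.
    rewrite eqxx ifF; last by lia.
    rewrite ifF; last by lia.
    by rewrite eqxx (take_nth false lx) rev_rcons R1.
  by do 4 (rewrite ifF; last by lia).
- case/andP=> li _; have [R1 R2] := R i li; rewrite R1.
  case E: (hget s i) => [|p].
    rewrite take0 /=; exists S => //; split=> // j lj; rewrite hget_set.
    by case: eqP => [->|_]; [rewrite R1 R2 E | apply: R].
  have lx : p < size x by rewrite -E.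
  rewrite (take_nth false lx) rev_rcons; eexists; first by rewrite if_same.
  split; first by rewrite /upd !addn2 !addn1.
  move=> j lj; have [Rj1 Rj2] := R j lj; rewrite hget_set /upd /=.
  have [->|nij] := eqVneq j i.
    rewrite !eqxx !ifF; try lia.
    by rewrite R2 E -(drop_nth false lx).
  by do 4 (rewrite ifF; last by lia).
- case/and3P=> li _ _; have [R1 R2] := R i li; rewrite R2.
  (* Beyond the input the automaton reads [false], and the empty stack takes the same branch. *)
  have [lx|lx] := ltnP (hget s i) (size x); last first.
    by rewrite drop_oversize // nth_default //; exists S.
  rewrite (drop_nth false lx); eexists; first by [].
  split; first by rewrite /upd !addn2.
  move=> j lj; have [Rj1 Rj2] := R j lj; rewrite /upd.
  have [->|nij] := eqVneq j i.
    rewrite !eqxx !ifF; try lia.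
    by rewrite -(drop_nth false lx) R1.
  by rewrite !ifF //; lia.
- case/and3P=> li _ _; have [R1 R2] := R i li; rewrite R1.
  case E: (hget s i) => [|p]; first by rewrite take0 /=; exists S.
  have lx : p < size x by rewrite -E.
  rewrite (take_nth false lx) rev_rcons; eexists; first by rewrite if_same.
  split; first by rewrite /upd !addn1.
  move=> j lj; have [Rj1 Rj2] := R j lj; rewrite /upd.
  have [->|nij] := eqVneq j i.
    rewrite !eqxx !ifF; try lia.
    by rewrite E (take_nth false lx) rev_rcons R2 E.
  by rewrite !ifF //; lia.
- move=> _; eexists; first by [].
  split; first by rewrite /upd eqxx R0 cats1 rev_rcons.
  by move=> j lj; have [Rj1 Rj2] := R j lj; rewrite /upd !ifF //; lia.
Qed.

Lemma pointer_run S c n : c.1.1 <= m -> heads_ok c.1.2 -> head_rel S c.1.2 c.2 ->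
  exists2 S', iter n sstep (c.1.1, S) = ((iter n fstep c).1.1, S') &
    head_rel S' (iter n fstep c).1.2 (iter n fstep c).2.
Proof.
move=> le ok R.
suff [S' [e R' _ _]] : exists S', [/\ iter n sstep (c.1.1, S) = ((iter n fstep c).1.1, S'),
    head_rel S' (iter n fstep c).1.2 (iter n fstep c).2,
    (iter n fstep c).1.1 <= m & heads_ok (iter n fstep c).1.2] by exists S'.
elim: n => [|n [S1 [e1 R1 le1 ok1]]]; first by exists S.
rewrite !iterS e1; case: (pointer_sim le1 ok1 R1) => S2 e2 R2; exists S2.
have [le2 ok2] := pstep_ok le1 ok1.
have fE : (fstep (iter n fstep c)).1 = pstep (iter n fstep c).1 by rewrite /fstep /pstep; case: ifP.
by split=> //; rewrite fE.
Qed.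

Lemma sstep_init j S : sstep (B + j, S) = sinstr_step (nth snop init_code j) S.
Proof.
rewrite /sstep /= ifF; last by rewrite /B; lia.
rewrite /scode nth_cat size_map ifF; last by rewrite /B -/m; lia.
by rewrite (_ : B + j - size pcode = j.+1) // /B /m; lia.
Qed.

(** One transfer and six pushes. The bit survives the transfer only in the program counter, hence
    the two copies of the pushes. *)
Lemma init_round S b r : S 0 = b :: r ->
  exists2 S', iter 7 sstep (B, S) = (B, S') &
   forall j, j <= 14 -> S' j = if j == 0 then r else if odd j then S j else b :: S j.
Proof.
move=> S0; rewrite -{1}[B]addn0.
rewrite !iterSr sstep_init /= S0.
case: b S0 => S0; rewrite !sstep_init /=; eexists; try by [].
  by do 15 (case=> [_|]; first by []).
by do 15 (case=> [_|]; first by []).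
Qed.

(** Stack 0 delivers the last input bit first, so the first bit ends on top of every right stack.
    The extra step is the exit. *)
Lemma init_run r acc S : S 0 = r ->
  (forall j, j <= 14 -> j != 0 -> S j = if odd j then [::] else acc) ->
  exists2 S', iter (1 + 7 * size r) sstep (B, S) = (0, S') &
   S' 0 = [::] /\ forall j, j <= 14 -> j != 0 -> S' j = if odd j then [::] else rev r ++ acc.
Proof.
elim: r acc S => [|b r IH] acc S S0 Sj.
  exists S; last by [].
  by rewrite /= -[B]addn0 sstep_init /= S0.
have [S1 e1 S1j] := init_round S0.
have [||S' e S'P] := IH (b :: acc) S1; first by rewrite S1j.
  by move=> j lj nj; rewrite S1j // (negbTE nj) Sj //; case: odd.
exists S'; last by rewrite rev_cons cat_rcons.
have -> : 1 + 7 * size (b :: r) = 1 + 7 * size r + 7 by rewrite /=; lia.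
by rewrite iterD e1.
Qed.

Lemma B_lt : B < size scode. Proof. by rewrite size_scode -addn1 leq_add2l. Qed.

Definition pointer_TM : TM := @sm_TM scode B m 14 B_lt.

(** With N = (|x| + 1)^7, the program and the initialization take at most (m + 9) N stack
    instructions, each costing at most (4 (m + 9) + 14) N long moves. The product N N is the source
    of the exponent 14 below; the 14 in [sm_W 14] is the number of stacks besides stack 0. *)
Definition pointer_coef : nat := (m + 9) * ((4 * (m + 9) + 14) * (sm_W 14).+1).

Lemma pointer_TM_correct n s y :
  iter n fstep (0, nseq nheads 0, [::]) = (m, s, y) ->
  tm_computes_within pointer_TM x y (pointer_coef * (size x).+1 ^ 14).
Proof.
move=> run.
have ok0 : heads_ok (nseq nheads 0) by [].
have runp : (iter n pstep (0, nseq nheads 0)).1 = m by rewrite -(fstep_fst n _ [::]) run.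
have [t le_t et] := pointer_halts_within ok0 runp.
have {}run : iter t fstep (0, nseq nheads 0, [::]) = (m, s, y).
  rewrite -run; have et' : (iter t fstep (0, nseq nheads 0, [::])).1.1 = m by rewrite fstep_fst.
  case/orP: (leq_total n t) => le.
    by rewrite -(subnK le) iterD run fstep_halt.
  by rewrite -(subnK le) iterD (fstep_halt _ et').
have [||S1 e1 [S10 S1j]] := @init_run (rev x) [::] (fun j => if j == 0 then rev x else [::]).
- by [].
- by move=> j _ /negbTE ->; case: odd.
have R1 : head_rel S1 (nseq nheads 0) [::].
  split=> // i li; rewrite /hget nth_nseq li take0 drop0.
  have l1 : 2 * i + 1 <= 14 by rewrite /nheads in li; lia.
  have l2 : 2 * i + 2 <= 14 by rewrite /nheads in li; lia.
  have o1 : odd (2 * i + 1) by rewrite oddD oddM.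
  have o2 : odd (2 * i + 2) = false by rewrite oddD oddM.
  by rewrite !S1j ?o1 ?o2 ?revK ?cats0 //; lia.
have [S2 e2 [S20 _]] := @pointer_run S1 (0, nseq nheads 0, [::]) t isT ok0 R1.
rewrite run /= in e2 S20.
have e : iter (t + (1 + 7 * size x)) sstep (B, fun j => if j == 0 then rev x else [::]) = (m, S2).
  by rewrite iterD -(size_rev x) e1 e2.
apply: (@sm_correct scode B m 14 isT scode_ok B_lt x y (t + (1 + 7 * size x))); rewrite ?e //=.
set N := (size x).+1 ^ nheads in le_t.
have N_gt : size x < N by rewrite /N expnS leq_pmulr // expn_gt0.
have le_k : t + (1 + 7 * size x) <= (m + 9) * N by rewrite mulnDl; rewrite mulSn in le_t; lia.
have -> : (size x).+1 ^ 14 = N * N by rewrite /N -expnD.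
have le_j : 4 * (size x + (t + (1 + 7 * size x))) + 10 <= (4 * (m + 9) + 14) * N by lia.
rewrite /pointer_coef.
apply: leq_trans (leq_mul le_k (leq_mul le_j (leqnn _))) _.
by rewrite [X in _ <= X](_ : _ = (m + 9) * N * ((4 * (m + 9) + 14) * N * (sm_W 14).+1)) //; ring.
Qed.

End Pointer.

(** * Structured programs *)

Inductive test := TBit of nat | TPos of nat.

Inductive cmd :=
  | CSkip
  | CR of nat
  | CL of nat
  | COut of bool
  | CSeq of cmd & cmd
  | CIf of test & cmd & cmd
  | CWhile of test & cmd.

Declare Scope cmd_scope.
Delimit Scope cmd_scope with cmd.
Bind Scope cmd_scope with cmd.
Notation "c1 ;; c2" := (CSeq c1 c2) (at level 60, right associativity) : cmd_scope.

Section Semantics.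
Variable x : seq bool.

Definition holds (t : test) (s : heads) : bool :=
  match t with TBit i => nth false x (hget s i) | TPos i => 0 < hget s i end.

(** [exec_R] has no rule at the right end, so a derivation guarantees that a head used as a counter
    never saturates. *)
Inductive exec : cmd -> heads -> heads -> seq bool -> Prop :=
  | exec_skip s : exec CSkip s s [::]
  | exec_R s i : hget s i < size x -> exec (CR i) s (hset s i (hget s i).+1) [::]
  | exec_L s i : exec (CL i) s (hset s i (hget s i).-1) [::]
  | exec_out s b : exec (COut b) s s [:: b]
  | exec_seq c1 c2 s s1 s2 o1 o2 :
      exec c1 s s1 o1 -> exec c2 s1 s2 o2 -> exec (CSeq c1 c2) s s2 (o1 ++ o2)
  | exec_ifT t c1 c2 s s' o : holds t s -> exec c1 s s' o -> exec (CIf t c1 c2) s s' o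
  | exec_ifF t c1 c2 s s' o : ~~ holds t s -> exec c2 s s' o -> exec (CIf t c1 c2) s s' o
  | exec_whileF t c s : ~~ holds t s -> exec (CWhile t c) s s [::]
  | exec_whileT t c s s1 s2 o1 o2 : holds t s -> exec c s s1 o1 -> exec (CWhile t c) s1 s2 o2 ->
      exec (CWhile t c) s s2 (o1 ++ o2).

Definition ptest (t : test) : nat -> nat -> pinstr :=
  match t with TBit i => PBit i | TPos i => PPos i end.

Definition pjmp (n : nat) : pinstr := PBit 0 n n.

Fixpoint csize (c : cmd) : nat :=
  match c with
  | CSkip => 0
  | CR _ | CL _ | COut _ => 1
  | CSeq c1 c2 => csize c1 + csize c2
  | CIf _ c1 c2 => (csize c1 + (csize c2).+1).+1
  | CWhile _ c => (csize c).+2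
  end.

Fixpoint compile (c : cmd) (b : nat) : seq pinstr :=
  match c with
  | CSkip => [::]
  | CR i => [:: PR i b.+1]
  | CL i => [:: PL i b.+1]
  | COut v => [:: POut v b.+1]
  | CSeq c1 c2 => compile c1 b ++ compile c2 (b + csize c1)
  | CIf t c1 c2 =>
      ptest t b.+1 (b.+1 + (csize c1).+1) :: compile c1 b.+1 ++
      pjmp (b + csize c) :: compile c2 (b.+1 + (csize c1).+1)
  | CWhile t c1 => ptest t b.+1 (b + csize c) :: rcons (compile c1 b.+1) (pjmp b)
  end.

Lemma size_compile c b : size (compile c b) = csize c.
Proof.
elim: c b => //= [c1 IH1 c2 IH2|t c1 IH1 c2 IH2|t c IH] b.
- by rewrite size_cat IH1 IH2.
- by rewrite size_cat /= IH1 IH2.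
- by rewrite size_rcons IH.
Qed.

Section Compile.
Variable code : seq pinstr.
Local Notation fstep := (fstep x code).

Definition at_pc (b : nat) (l : seq pinstr) : Prop :=
  forall k, k < size l -> b + k < size code /\ nth pnop code (b + k) = nth pnop l k.

Lemma at_cat b l1 l2 : at_pc b (l1 ++ l2) -> at_pc b l1 /\ at_pc (b + size l1) l2.
Proof.
move=> H; split=> k lk.
  by have := H k; rewrite size_cat nth_cat lk; apply; rewrite ltn_addr.
have := H (size l1 + k); rewrite size_cat nth_cat ltn_add2l addnA addKn ifF; last by lia.
exact.
Qed.

Lemma at_cons b i l : at_pc b (i :: l) ->
  [/\ b < size code, nth pnop code b = i & at_pc b.+1 l].
Proof.
move=> H; have [] := H 0 isT; rewrite addn0 => h1 h2; split=> // k lk.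
by have := H k.+1 lk; rewrite addnS.
Qed.

Lemma fstep_at b i s o : b < size code -> nth pnop code b = i ->
  iter 1 fstep (b, s, o) = (pexec x i s, o ++ pemit i).
Proof. by move=> lt <-; rewrite /= /fstep /= ltn_eqF. Qed.

Definition runs (b : nat) (s : heads) (b' : nat) (s' : heads) (o : seq bool) : Prop :=
  forall o0, exists n, iter n fstep (b, s, o0) = (b', s', o0 ++ o).

Lemma runs_trans b1 s1 b2 s2 o1 o2 b3 s3 :
  runs b1 s1 b2 s2 o1 -> runs b2 s2 b3 s3 o2 -> runs b1 s1 b3 s3 (o1 ++ o2).
Proof.
move=> R1 R2 o0; have [n1 e1] := R1 o0; have [n2 e2] := R2 (o0 ++ o1).
by exists (n2 + n1); rewrite iterD e1 e2 catA.
Qed.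

Lemma runs_step b i s : b < size code -> nth pnop code b = i ->
  runs b s (pexec x i s).1 (pexec x i s).2 (pemit i).
Proof. by move=> lt e o0; exists 1; rewrite (fstep_at _ _ lt e); case: pexec. Qed.

Lemma pexec_ptest t s n n' : pexec x (ptest t n n') s = (if holds t s then n else n', s).
Proof. by case: t. Qed.

Lemma pemit_ptest t n n' : pemit (ptest t n n') = [::].
Proof. by case: t. Qed.

Lemma runs_ptest b t s n n' : b < size code -> nth pnop code b = ptest t n n' ->
  runs b s (if holds t s then n else n') s [::].
Proof. by move=> lt e; have := runs_step s lt e; rewrite pexec_ptest pemit_ptest. Qed.

Lemma runs_pjmp b s n : b < size code -> nth pnop code b = pjmp n -> runs b s n s [::].
Proof. by move=> lt e; have := runs_step s lt e; rewrite /= if_same. Qed.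

Lemma compile_correct c s s' o : exec c s s' o ->
  forall b, at_pc b (compile c b) -> runs b s (b + csize c) s' o.
Proof.
elim=> {c s s' o} /=.
- by move=> s b _ o0; exists 0; rewrite addn0 cats0.
- move=> s i lt b /at_cons[l e _]; have := runs_step s l e.
  by rewrite /= lt addn1.
- by move=> s i b /at_cons[l e _]; have := runs_step s l e; rewrite /= addn1.
- by move=> s v b /at_cons[l e _]; have := runs_step s l e; rewrite /= addn1.
- move=> c1 c2 s s1 s2 o1 o2 _ IH1 _ IH2 b /at_cat[].
  rewrite size_compile => /IH1 R1 /IH2 R2.
  by rewrite addnA; apply: runs_trans R1 R2.
- move=> t c1 c2 s s' o ht _ IH b /at_cons[l e /at_cat[/IH R1]].
  rewrite size_compile => /at_cons[l2 e2 _].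
  have R0 := runs_ptest s l e; rewrite ht in R0.
  rewrite -[o]cats0 -[o ++ [::]]cat0s; apply: runs_trans R0 (runs_trans R1 _).
  by have := runs_pjmp s' l2 e2.
- move=> t c1 c2 s s' o ht _ IH b /at_cons[l e /at_cat[_]].
  rewrite size_compile => /at_cons[_ _]; rewrite -addnS => /IH R1.
  have R0 := runs_ptest s l e; rewrite (negbTE ht) in R0.
  have := runs_trans R0 R1; congr (runs _ _ _ _ _); lia.
- move=> t c s ht b /at_cons[l e _].
  by have := runs_ptest s l e; rewrite (negbTE ht).
- move=> t c s s1 s2 o1 o2 ht _ IH1 _ IH2 b Hb.
  have R2 := IH2 b Hb.
  case/at_cons: Hb => l e; rewrite -cats1 => /at_cat[/IH1 R1].
  rewrite size_compile => /at_cons[l2 e2 _].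
  have R0 := runs_ptest s l e; rewrite ht in R0.
  have R3 := runs_pjmp s1 l2 e2.
  have := runs_trans R0 (runs_trans R1 (runs_trans R3 R2)).
  by rewrite /= addnS.
Qed.

End Compile.
End Semantics.

Definition cmd_TM (c : cmd) : TM := pointer_TM (compile c 0).

Lemma cmd_TM_correct c x s y : all (pinstr_ok (compile c 0)) (compile c 0) ->
  exec x c (nseq nheads 0) s y ->
  tm_computes_within (cmd_TM c) x y (pointer_coef (compile c 0) * (size x).+1 ^ 14).
Proof.
move=> ok run.
have [//|n e] := compile_correct run (code := compile c 0) (b := 0) _ [::].
apply: (pointer_TM_correct ok (n := n) (s := s)).
by rewrite e add0n size_compile.
Qed.

Local Open Scope cmd_scope.

(** * The kernelization program *)

Lemma drop_consP (x : seq bool) p b w : drop p x = b :: w ->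
  [/\ p < size x, nth false x p = b & drop p.+1 x = w].
Proof.
move=> e; have lt : p < size x by rewrite ltnNge; apply/negP => /drop_oversize; rewrite e.
by move: e; rewrite (drop_nth false lt) => -[<- <-].
Qed.

Lemma drop_catP (x : seq bool) p w r : drop p x = w ++ r -> drop (p + size w) x = r.
Proof. by move=> e; rewrite addnC -drop_drop e drop_size_cat. Qed.

Lemma hget_hset s i v : hget (hset s i v) i = v.
Proof. by rewrite /hget nth_set_nth /= eqxx. Qed.

Lemma hset_hset s i v w : hset (hset s i v) i w = hset s i w.
Proof. by rewrite /hset set_set_nth eqxx. Qed.

Lemma hset_id s i : i < size s -> hset s i (hget s i) = s.
Proof.
move=> lt; apply: (@eq_from_nth _ 0); first by rewrite size_set_nth (maxn_idPr lt).
by move=> j _; rewrite nth_set_nth /=; case: eqP => // ->.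
Qed.

Lemma size_hset s i v : i < size s -> size (hset s i v) = size s.
Proof. by move=> lt; rewrite size_set_nth (maxn_idPr lt). Qed.

Definition zero i := CWhile (TPos i) (CL i).
Definition set1 i := zero i;; CR i.
(* Head j is moved to the position of head i; head k is scratch. *)
Definition copy i j k :=
  zero j;; zero k;; CWhile (TPos i) (CL i;; CR k;; CR j);; CWhile (TPos k) (CL k;; CR i).

(** Follows [enc_list]: [mark] treats the bit announcing an element or the end of the list, [body]
    the element itself. *)
Definition walk_list i body mark := CWhile (TBit i) (mark;; body);; mark.
(** A positive number is encoded like a list whose elements are single digits. *)
Definition walk_N i st := CIf (TBit i) (st;; walk_list i st st) st.
Definition skip_N i := walk_N i (CR i).
Definition skip_int i := CR i;; skip_N i.
Definition skip_ex i := walk_list i (skip_int i) (CR i).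
Definition skip_exs i := walk_list i (skip_ex i) (CR i).
Definition echo i := CIf (TBit i) (COut true) (COut false);; CR i.
Definition echo_N i := walk_N i (echo i).

(* Heads: 0 scans the instance, 1 scans the examples it is compared with,
   2 is a copy of 0, 3 and 5 are scratch, 4 counts features, and 6 holds the
   result of a comparison. *)
Definition lt_bits i j :=
  CWhile (TBit i)
    (CIf (TBit j)
      (CR i;; CR j;;
       CIf (TBit i) (CIf (TBit j) CSkip (zero 6)) (CIf (TBit j) (set1 6) CSkip);;
       CR i;; CR j)
      (zero 6;; CWhile (TBit i) (CR i;; CR i)));;
  CR i;; CWhile (TBit j) (set1 6;; CR j;; CR j);; CR j.

Definition lt_N i j :=
  CIf (TBit i)
    (CIf (TBit j) (CR i;; CR j;; zero 6;; lt_bits i j) (CR j;; zero 6;; skip_N i))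
    (CIf (TBit j) (CR i;; set1 6;; skip_N j) (CR i;; CR j;; zero 6)).

Definition lt_int :=
  CIf (TBit 1)
    (CIf (TBit 2) (CR 1;; CR 2;; lt_N 2 1) (set1 6;; skip_int 1))
    (CIf (TBit 2) (zero 6;; skip_int 1) (CR 1;; CR 2;; lt_N 1 2)).

(** Counter 4 is moved to 5 while that many values are skipped, then moved back. A smaller value
    makes the row emit one digit 0. What remains of the row is itself an encoded list, so [skip_ex]
    finishes it. *)
Definition compare_row :=
  CWhile (TPos 4) (CL 4;; CR 5;; CR 1;; skip_int 1);;
  CWhile (TPos 5) (CL 5;; CR 4);;
  CR 1;; copy 0 2 3;; lt_int;;
  CIf (TPos 6) (COut true;; COut false) CSkip;;
  skip_ex 1.

(** The first two bits say nonnegative and nonzero, the rows contribute the zero digits, and the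
    last bit is the leading 1 of the power of two. *)
Definition emit_value :=
  COut false;; COut true;; zero 1;; skip_N 1;;
  walk_list 1 compare_row (CR 1);; walk_list 1 compare_row (CR 1);; COut false.

Definition emit_example :=
  zero 4;; walk_list 0 (emit_value;; skip_int 0;; CR 4) (echo 0).

(** The example lists serve as a unary counter: each example allows one more digit to be copied. *)
Definition emit_budget :=
  CIf (TBit 0)
    (echo 0;; zero 1;; skip_N 1;;
     walk_list 1 (skip_ex 1;; CIf (TBit 0) (echo 0;; echo 0) CSkip) (CR 1);;
     walk_list 1 (skip_ex 1;; CIf (TBit 0) (echo 0;; echo 0) CSkip) (CR 1);;
     COut false)
    (COut false).

Definition emit_trivial := COut false;; COut false;; COut false;; COut false.

Definition kernel_cmd :=
  skip_N 0;;
  CIf (TBit 0)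
    (skip_exs 0;;
     CIf (TBit 0)
       (zero 0;; echo_N 0;; walk_list 0 emit_example (echo 0);;
        walk_list 0 emit_example (echo 0);; emit_budget)
       emit_trivial)
    emit_trivial.

Lemma kernel_cmd_ok : all (pinstr_ok (compile kernel_cmd 0)) (compile kernel_cmd 0).
Proof. by vm_compute. Qed.

(** * Commands that scan an encoded object *)

Fixpoint pos_bits (p : positive) : seq bool :=
  match p with xH => [::] | xO p => false :: pos_bits p | xI p => true :: pos_bits p end.

Lemma enc_posE p : enc_pos p = enc_list (fun v => [:: v]) (pos_bits p).
Proof. by elim: p => //= p ->. Qed.

Section Spec.
Variable x : seq bool.
Local Notation exec := (exec x).
Local Notation holds := (holds x).

Lemma exec_cat c1 c2 s s1 s2 o1 o2 o :
  exec c1 s s1 o1 -> exec c2 s1 s2 o2 -> o = o1 ++ o2 -> exec (c1;; c2) s s2 o.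
Proof. by move=> h1 h2 ->; apply: exec_seq h1 h2. Qed.

Lemma exec_nil c1 c2 s s1 s2 o : exec c1 s s1 [::] -> exec c2 s1 s2 o -> exec (c1;; c2) s s2 o.
Proof. by move=> h1 h2; apply: exec_cat h1 h2 _. Qed.

Lemma exec_seq_inv c1 c2 s s' o : exec (c1;; c2) s s' o ->
  exists s1 o1 o2, [/\ exec c1 s s1 o1, exec c2 s1 s' o2 & o = o1 ++ o2].
Proof. by move=> h; inversion h; subst; do 3 eexists; split; eauto. Qed.

Lemma exec_unroll t c d s s1 s2 o1 o2 : holds t s -> exec c s s1 o1 ->
  exec (CWhile t c;; d) s1 s2 o2 -> exec (CWhile t c;; d) s s2 (o1 ++ o2).
Proof.
move=> ht h1 /exec_seq_inv[s3 [o3 [o4 [h3 h4 ->]]]].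
by rewrite catA; apply: exec_seq h4; apply: exec_whileT h1 h3.
Qed.

Lemma exec_exit t c d s s2 o : ~~ holds t s -> exec d s s2 o -> exec (CWhile t c;; d) s s2 o.
Proof. by move=> ht h; apply: exec_nil h; apply: exec_whileF. Qed.

Lemma exec_zero s i : i < size s -> exec (zero i) s (hset s i 0) [::].
Proof.
move E: (hget s i) => n; elim: n s E => [|n IH] s E lt.
  by rewrite -E hset_id //; apply: exec_whileF; rewrite /= E.
apply: (@exec_whileT _ _ _ _ _ _ [::] [::] _ (exec_L _ _ _)); first by rewrite /= E.
by rewrite E -(hset_hset s i n 0); apply: IH; rewrite ?hget_hset ?size_hset.
Qed.

Lemma exec_set1 s i : i < size s -> 0 < size x -> exec (set1 i) s (hset s i 1) [::].
Proof.
move=> lt x0; apply: exec_nil (exec_zero lt) _.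
have -> : hset s i 1 = hset (hset s i 0) i (hget (hset s i 0) i).+1.
  by rewrite hset_hset hget_hset.
by apply: exec_R; rewrite hget_hset.
Qed.

(** Describes commands that move head [i] only and whose output depends on nothing but the word
    passed over; this makes them compose like the encodings. *)
Definition consumes i c w o : Prop := forall s r, i < size s ->
  drop (hget s i) x = w ++ r -> exec c s (hset s i (hget s i + size w)) o.

Lemma consumes_R i b : consumes i (CR i) [:: b] [::].
Proof. by move=> s r lt /drop_consP[lx _ _]; rewrite addn1; apply: exec_R. Qed.

Lemma consumes_echo i b : consumes i (echo i) [:: b] [:: b].
Proof.
move=> s r lt e; have [lx nx _] := drop_consP e.
apply: (@exec_cat _ _ s s _ [:: b] [::] _ _ (consumes_R lt e)) => //.
by case: b nx {e} => nx; [apply: exec_ifT | apply: exec_ifF]; rewrite /= ?nx //; apply: exec_out.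
Qed.

Lemma consumes_seq i c1 c2 w1 w2 o1 o2 :
  consumes i c1 w1 o1 -> consumes i c2 w2 o2 -> consumes i (c1;; c2) (w1 ++ w2) (o1 ++ o2).
Proof.
move=> h1 h2 s r lt; rewrite -catA => e.
apply: exec_cat (h1 _ _ lt e) _ (erefl _).
have e2 := drop_catP e.
have := h2 (hset s i (hget s i + size w1)) r.
by rewrite size_hset // hget_hset hset_hset size_cat addnA; apply.
Qed.

Lemma consumes_list (T : Type) (enc : T -> seq bool) (l : seq T) i body mark om out :
  (forall b, consumes i mark [:: b] (om b)) ->
  (forall y, consumes i body (enc y) (out y)) ->
  consumes i (walk_list i body mark) (enc_list enc l)
    (foldr (fun y o => om true ++ out y ++ o) (om false) l).
Proof.
move=> hm hb s r lt; elim: l s lt => [|y l IH] s lt e /=.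
  apply: exec_exit (hm _ _ _ lt e).
  by have [_ nx _] := drop_consP e; rewrite /= nx.
rewrite [om true ++ _]catA; have [_ nx e1] := drop_consP e.
have e2 : drop (hget s i) x = (true :: enc y) ++ (enc_list enc l ++ r) by rewrite e /= -catA.
apply: (exec_unroll (s1 := hset s i (hget s i + size (true :: enc y)))).
- by rewrite /= nx.
- exact: (consumes_seq (hm true) (hb y)) lt e2.
have := IH (hset s i (hget s i + size (true :: enc y))).
rewrite size_hset // hget_hset hset_hset => /(_ lt (drop_catP e2)).
by congr (exec _ _ (hset _ _ _) _); rewrite /= size_cat; lia.
Qed.

Definition echoed (b : bool) (w : seq bool) := if b then w else [::].

Lemma consumes_pos i st b p : (forall v, consumes i st [:: v] (echoed b [:: v])) ->
  consumes i (walk_list i st st) (enc_pos p) (echoed b (enc_pos p)).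
Proof.
move=> hs.
have := consumes_list (enc := fun v => [:: v]) (l := pos_bits p) hs hs.
rewrite -enc_posE; congr (consumes _ _ _ _).
by case: b {hs}; elim: p => //= p ->.
Qed.

Lemma consumes_N i st b n : (forall v, consumes i st [:: v] (echoed b [:: v])) ->
  consumes i (walk_N i st) (enc_N n) (echoed b (enc_N n)).
Proof.
move=> hs s r lt e; case: n e => [|p] e /=.
  by apply: exec_ifF (hs _ _ _ lt e); have [_ nx _] := drop_consP e; rewrite /= nx.
apply: exec_ifT; first by have [_ nx _] := drop_consP e; rewrite /= nx.
have := consumes_seq (hs true) (consumes_pos (p := p) hs) lt e.
by congr (exec _ _ _ _); case: (b).
Qed.

Lemma consumes_skip_N i n : consumes i (skip_N i) (enc_N n) [::].
Proof. exact: (consumes_N (b := false) (n := n) (@consumes_R i)). Qed.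

Lemma consumes_echo_N i n : consumes i (echo_N i) (enc_N n) (enc_N n).
Proof. exact: (consumes_N (b := true) (n := n) (@consumes_echo i)). Qed.

Lemma consumes_int i z : consumes i (skip_int i) (enc_int z) [::].
Proof.
by case: z => n; exact: (consumes_seq (@consumes_R i _) (@consumes_skip_N i _)).
Qed.

Lemma consumes_skip_list (T : Type) (enc : T -> seq bool) (l : seq T) i body :
  (forall y, consumes i body (enc y) [::]) ->
  consumes i (walk_list i body (CR i)) (enc_list enc l) [::].
Proof.
move=> hb; have := consumes_list (l := l) (@consumes_R i) hb.
by congr (consumes _ _ _ _); elim: (l).
Qed.

Lemma consumes_ex i e : consumes i (skip_ex i) (enc_list enc_int e) [::].
Proof. by apply: consumes_skip_list; apply: consumes_int. Qed.

Lemma consumes_exs i l : consumes i (skip_exs i) (enc_list (enc_list enc_int) l) [::].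
Proof. by apply: consumes_skip_list; apply: consumes_ex. Qed.

End Spec.

(** * Comparison of encoded numbers *)

Definition is_lt (r : comparison) : bool := if r is Lt then true else false.

Section Compare.
Variable x : seq bool.
Local Notation exec := (exec x).

(** The roles of heads 1 and 2 are exchanged for negative numbers, so the two heads stay abstract;
    [mk u v g] is the head vector as a function of both positions and of the flag. *)
Variables (i j : nat) (mk : nat -> nat -> nat -> heads).
Hypotheses (geti : forall u v g, hget (mk u v g) i = u)
           (getj : forall u v g, hget (mk u v g) j = v)
           (seti : forall u v g w, hset (mk u v g) i w = mk w v g)
           (setj : forall u v g w, hset (mk u v g) j w = mk u w g)
           (setg : forall u v g w, hset (mk u v g) 6 w = mk u v w)
           (szi : forall u v g, i < size (mk u v g))
           (szj : forall u v g, j < size (mk u v g))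
           (szg : forall u v g, 6 < size (mk u v g)).

Lemma mk_Ri u v g b w : drop u x = b :: w -> exec (CR i) (mk u v g) (mk u.+1 v g) [::].
Proof.
case/drop_consP=> lt _ _.
by have := @exec_R x (mk u v g) i; rewrite geti seti; apply.
Qed.

Lemma mk_Rj u v g b w : drop v x = b :: w -> exec (CR j) (mk u v g) (mk u v.+1 g) [::].
Proof.
case/drop_consP=> lt _ _.
by have := @exec_R x (mk u v g) j; rewrite getj setj; apply.
Qed.

Lemma mk_zero u v g : exec (zero 6) (mk u v g) (mk u v 0) [::].
Proof. by rewrite -(setg u v g 0); apply: exec_zero. Qed.

Lemma mk_set1 u v g : 0 < size x -> exec (set1 6) (mk u v g) (mk u v 1) [::].
Proof. by move=> x0; rewrite -(setg u v g 1); apply: exec_set1. Qed.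

Lemma mk_consumes_i c w o u v g r : consumes x i c w o -> drop u x = w ++ r ->
  exec c (mk u v g) (mk (u + size w) v g) o.
Proof.
by move=> h e; have := h (mk u v g) r; rewrite geti seti; apply.
Qed.

Lemma mk_consumes_j c w o u v g r : consumes x j c w o -> drop v x = w ++ r ->
  exec c (mk u v g) (mk u (v + size w) g) o.
Proof.
by move=> h e; have := h (mk u v g) r; rewrite getj setj; apply.
Qed.

Lemma mk_biti u v g b w : drop u x = b :: w -> holds x (TBit i) (mk u v g) = b.
Proof. by case/drop_consP=> _ nx _; rewrite /= geti. Qed.

Lemma mk_bitj u v g b w : drop v x = b :: w -> holds x (TBit j) (mk u v g) = b.
Proof. by case/drop_consP=> _ nx _; rewrite /= getj. Qed.

Lemma drop_size_gt0 p b w : drop p x = b :: w -> 0 < size x.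
Proof. by case/drop_consP=> lt _ _; apply: leq_ltn_trans lt. Qed.

Lemma drop2 p a b w : drop p x = [:: a, b & w] -> drop p.+2 x = w.
Proof. by case/drop_consP=> _ _ /drop_consP[]. Qed.

Lemma exec_lt_tail u v g q r1 r : drop u x = false :: r1 -> drop v x = enc_pos q ++ r ->
  exec (CR i;; CWhile (TBit j) (set1 6;; CR j;; CR j);; CR j) (mk u v g)
     (mk u.+1 (v + size (enc_pos q)) (if q is xH then g else 1)) [::].
Proof.
move=> eu ev; apply: exec_nil (mk_Ri _ _ eu) _.
suff H : forall q v g, drop v x = enc_pos q ++ r ->
   exec (CWhile (TBit j) (set1 6;; CR j;; CR j);; CR j) (mk u.+1 v g)
      (mk u.+1 (v + size (enc_pos q)) (if q is xH then g else 1)) [::] by apply: H.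
have D q' v' g' b : (forall v g, drop v x = enc_pos q' ++ r ->
     exec (CWhile (TBit j) (set1 6;; CR j;; CR j);; CR j) (mk u.+1 v g)
      (mk u.+1 (v + size (enc_pos q')) (if q' is xH then g else 1)) [::]) ->
   drop v' x = [:: true, b & enc_pos q'] ++ r ->
   exec (CWhile (TBit j) (set1 6;; CR j;; CR j);; CR j) (mk u.+1 v' g')
      (mk u.+1 (v' + (size (enc_pos q')).+2) 1) [::].
  move=> IH e; have [_ _ e1] := drop_consP e; have [_ _ e2] := drop_consP e1.
  rewrite -[[::]]cat0s; apply: (exec_unroll (s1 := mk u.+1 v'.+2 1)).
  - by rewrite (mk_bitj _ _ e).
  - apply: exec_nil (mk_set1 _ _ _ (drop_size_gt0 e)) _.
    by apply: exec_nil (mk_Rj _ _ e) (mk_Rj _ _ e1).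
  have := IH v'.+2 1 e2; rewrite !addSnnS.
  by case: (q').
elim=> [q' IH|q' IH|] v' g' e.
- exact: D IH e.
- exact: D IH e.
apply: exec_exit; first by rewrite (mk_bitj _ _ e).
by rewrite /= addn1; apply: mk_Rj e.
Qed.

(** With low digits first, the last pair of different digits decides unless one number is longer.
    This is the recursion of [Pos.compare_cont], whose accumulator the flag mirrors up to
    [is_lt]. *)
Lemma exec_lt_bits p q r u v g r1 r2 :
  drop u x = enc_pos p ++ r1 -> drop v x = enc_pos q ++ r2 -> g = is_lt r ->
  exec (lt_bits i j) (mk u v g)
    (mk (u + size (enc_pos p)) (v + size (enc_pos q)) (is_lt (Pos.compare_cont r p q))) [::].
Proof.
have step (b b' : bool) p' q' u' v' (g' g'' : bool) (s2 : heads) :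
   drop u' x = [:: true, b & enc_pos p'] ++ r1 ->
   drop v' x = [:: true, b' & enc_pos q'] ++ r2 ->
   g'' = (if b == b' then g' else b') ->
   exec (lt_bits i j) (mk u'.+2 v'.+2 g'') s2 [::] -> exec (lt_bits i j) (mk u' v' g') s2 [::].
  move=> eu ev eg IH; have [_ _ eu1] := drop_consP eu; have [_ _ ev1] := drop_consP ev.
  rewrite -[[::]]cat0s; apply: exec_unroll IH; first by rewrite (mk_biti _ _ eu).
  apply: exec_ifT; first by rewrite (mk_bitj _ _ ev).
  apply: exec_nil (mk_Ri _ _ eu) _; apply: exec_nil (mk_Rj _ _ ev) _.
  apply: (@exec_nil _ _ _ _ (mk u'.+1 v'.+1 g'')); last first.
    by apply: exec_nil (mk_Ri _ _ eu1) (mk_Rj _ _ ev1).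
  have x0 := drop_size_gt0 eu.
  by case: b b' eu1 ev1 eg {eu ev} => -[] eu1 ev1 -> /=;
    [apply: exec_ifT | apply: exec_ifT | apply: exec_ifF | apply: exec_ifF];
    rewrite ?(mk_biti _ _ eu1) //;
    [apply: exec_ifT | apply: exec_ifF | apply: exec_ifT | apply: exec_ifF];
    rewrite ?(mk_bitj _ _ ev1) //; do ?[exact: exec_skip | exact: mk_zero | exact: mk_set1].
(* If the first number has more digits, the flag is cleared whatever the low digits said, and the
   remaining digits are skipped. *)
have longer b p' u' v' g' :
   drop u' x = [:: true, b & enc_pos p'] ++ r1 -> drop v' x = enc_pos xH ++ r2 ->
   exec (lt_bits i j) (mk u' v' g') (mk (u' + (size (enc_pos p')).+2) (v' + 1) 0) [::].
  move=> eu ev; have [_ _ eu1] := drop_consP eu; have [_ _ eu2] := drop_consP eu1.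
  have W : forall p u, drop u x = enc_pos p ++ r1 ->
     exec (CWhile (TBit i) (CR i;; CR i)) (mk u v' 0) (mk (u + (size (enc_pos p)).-1) v' 0) [::] /\
     drop (u + (size (enc_pos p)).-1) x = false :: r1.
    have D b' p1 u1 : (forall u, drop u x = enc_pos p1 ++ r1 ->
       exec (CWhile (TBit i) (CR i;; CR i)) (mk u v' 0) (mk (u + (size (enc_pos p1)).-1) v' 0) [::] /\
       drop (u + (size (enc_pos p1)).-1) x = false :: r1) ->
     drop u1 x = [:: true, b' & enc_pos p1] ++ r1 ->
       exec (CWhile (TBit i) (CR i;; CR i)) (mk u1 v' 0) (mk (u1 + (size (enc_pos p1)).+1) v' 0) [::] /\
       drop (u1 + (size (enc_pos p1)).+1) x = false :: r1.
      move=> IH e; have [_ _ e1] := drop_consP e; have [_ _ e2] := drop_consP e1.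
      have -> : u1 + (size (enc_pos p1)).+1 = u1.+2 + (size (enc_pos p1)).-1.
        by have : 0 < size (enc_pos p1); [case: (p1) | lia].
      have [IH1 IH2] := IH _ e2; split=> //.
      rewrite -[[::]]cat0s; apply: exec_whileT IH1; first by rewrite (mk_biti _ _ e).
      by apply: exec_nil (mk_Ri _ _ e) (mk_Ri _ _ e1).
    elim=> [p1 IH|p1 IH|] u1 e; [exact: D IH e | exact: D IH e | ].
    by rewrite addn0; split=> //; apply: exec_whileF; rewrite (mk_biti _ _ e).
  have p0 : 0 < size (enc_pos p') by case: (p').
  have [W1 W2] := W _ _ eu2.
  have T := exec_lt_tail 0 W2 ev.
  have -> : u' + (size (enc_pos p')).+2 = (u'.+2 + (size (enc_pos p')).-1).+1 by lia.
  rewrite -[[::]]cat0s; apply: exec_unroll.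
  - by rewrite (mk_biti _ _ eu).
  - apply: exec_ifF; first by rewrite (mk_bitj _ _ ev).
    apply: exec_nil (mk_zero _ _ _) _.
    rewrite -[[::]]cat0s; apply: exec_whileT W1; first by rewrite (mk_biti _ _ eu).
    by apply: exec_nil (mk_Ri _ _ eu) (mk_Ri _ _ eu1).
  by apply: exec_exit T; rewrite (mk_biti _ _ W2).
elim: p q r u v g => [p IH|p IH|] q r u v g eu ev ->.
- case: q ev => [q|q|] ev /=.
  + have IH' := IH q r _ _ _ (drop2 eu) (drop2 ev) (erefl _).
    by apply: (step _ _ _ _ _ _ _ _ _ eu ev (erefl _)); rewrite -!addSnnS.
  + have IH' := IH q Gt _ _ _ (drop2 eu) (drop2 ev) (erefl _).
    by apply: (step _ _ _ _ _ _ _ _ _ eu ev (erefl _)); rewrite -!addSnnS.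
  + exact: longer eu ev.
- case: q ev => [q|q|] ev /=.
  + have IH' := IH q Lt _ _ _ (drop2 eu) (drop2 ev) (erefl _).
    by apply: (step _ _ _ _ _ _ _ _ _ eu ev (erefl _)); rewrite -!addSnnS.
  + have IH' := IH q r _ _ _ (drop2 eu) (drop2 ev) (erefl _).
    by apply: (step _ _ _ _ _ _ _ _ _ eu ev (erefl _)); rewrite -!addSnnS.
  + exact: longer eu ev.
apply: exec_exit; first by rewrite (mk_biti _ _ eu).
have := exec_lt_tail (is_lt r) eu ev; rewrite addn1.
by case: q ev.
Qed.

Lemma exec_lt_N a b u v g r1 r2 :
  drop u x = enc_N a ++ r1 -> drop v x = enc_N b ++ r2 ->
  exec (lt_N i j) (mk u v g)
    (mk (u + size (enc_N a)) (v + size (enc_N b)) (is_lt (N.compare a b))) [::].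
Proof.
move=> eu ev; have x0 : 0 < size x by case: (a) eu => [|p] /drop_size_gt0.
case: a eu => [|p] eu; case: b ev => [|q] ev.
- apply: exec_ifF; first by rewrite (mk_biti _ _ eu).
  apply: exec_ifF; first by rewrite (mk_bitj _ _ ev).
  rewrite !addn1; apply: exec_nil (mk_Ri _ _ eu) _; apply: exec_nil (mk_Rj _ _ ev) _.
  exact: mk_zero.
- apply: exec_ifF; first by rewrite (mk_biti _ _ eu).
  apply: exec_ifT; first by rewrite (mk_bitj _ _ ev).
  rewrite addn1; apply: exec_nil (mk_Ri _ _ eu) _; apply: exec_nil (mk_set1 _ _ _ x0) _.
  by apply: mk_consumes_j ev; apply: consumes_skip_N.
- apply: exec_ifT; first by rewrite (mk_biti _ _ eu).
  apply: exec_ifF; first by rewrite (mk_bitj _ _ ev).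
  rewrite addn1; apply: exec_nil (mk_Rj _ _ ev) _; apply: exec_nil (mk_zero _ _ _) _.
  by apply: mk_consumes_i eu; apply: consumes_skip_N.
- apply: exec_ifT; first by rewrite (mk_biti _ _ eu).
  apply: exec_ifT; first by rewrite (mk_bitj _ _ ev).
  have [_ _ eu1] := drop_consP eu; have [_ _ ev1] := drop_consP ev.
  apply: exec_nil (mk_Ri _ _ eu) _; apply: exec_nil (mk_Rj _ _ ev) _.
  apply: exec_nil (mk_zero _ _ _) _.
  by rewrite /= -!addSnnS; exact: (exec_lt_bits (r := Eq) (g := false) eu1 ev1 (erefl _)).
Qed.

End Compare.

Lemma is_lt_nat n m : is_lt (N.compare (N.of_nat n) (N.of_nat m)) = (n < m).
Proof.
rewrite -Nnat.Nat2N.inj_compare.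
by case: (PeanoNat.Nat.compare_spec n m) => h /=; lia.
Qed.

(** * The kernel and its encoding *)

Definition rank (l : seq (seq int)) (f : nat) (v : int) : nat :=
  count (fun e => (exval e f < v)%R) l.

Fixpoint compress_from (l : seq (seq int)) (f : nat) (e : seq int) : seq int :=
  if e is v :: e' then Posz (2 ^ rank l f v) :: compress_from l f.+1 e' else [::].

Definition compress l e := compress_from l 0 e.

Fixpoint pos_take (m : nat) (p : positive) : positive :=
  match m, p with
  | m'.+1, xO p' => xO (pos_take m' p')
  | m'.+1, xI p' => xI (pos_take m' p')
  | _, _ => xH
  end.

(* The m low-order binary digits of b below a new leading 1, or b itself if
   it has at most m digits below its leading 1. *)
Definition trunc (m b : nat) : nat :=
  if N.of_nat b is Npos p then Pos.to_nat (pos_take m p) else 0.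

(** If a class is empty then [delta_max] is 0 and says nothing about the size of the other class,
    hence the separate constant instance. *)
Definition kernel (I : Inst) : Inst :=
  let E := inst_ci I in let l := pos E ++ neg E in
  if (pos E == [::]) || (neg E == [::]) then mkInst (mkCI 0 [::] [::]) 0
  else mkInst (mkCI (nfeat E) (map (compress l) (pos E)) (map (compress l) (neg E)))
              (trunc (size l) (budget I)).

Lemma enc_nat_pow2 r : enc_nat (2 ^ r) = true :: flatten (nseq r [:: true; false]) ++ [:: false].
Proof.
have H : N.of_nat (2 ^ r) = Npos (iter r xO xH).
  elim: r => // r IH; rewrite expnS.
  have -> : 2 * 2 ^ r = (2 * 2 ^ r)%coq_nat by [].
  by rewrite Nnat.Nat2N.inj_mul IH.
by rewrite /enc_nat H /=; congr (_ :: _); elim: {H} r => //= r ->.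
Qed.

Lemma enc_int_pow_count (T : Type) (P : pred T) (l : seq T) :
  enc_int (Posz (2 ^ count P l)) =
  [:: false; true] ++ flatten [seq if P y then [:: true; false] else [::] | y <- l] ++ [:: false].
Proof.
rewrite /= enc_nat_pow2 /=; congr [:: _, _ & _ ++ _].
by elim: l => //= y l <-; case: (P y).
Qed.

(** The digits copied during a scan; [pos_drop] is what is left for the next one, as the budget is
    copied in a scan of the positive and a scan of the negative examples. *)
Fixpoint pos_prefix (m : nat) (p : positive) : seq bool :=
  match m, p with
  | m'.+1, xO p' => [:: true, false & pos_prefix m' p']
  | m'.+1, xI p' => [:: true, true & pos_prefix m' p']
  | _, _ => [::]
  end.

Fixpoint pos_drop (m : nat) (p : positive) : positive :=
  match m, p with
  | m'.+1, xO p' | m'.+1, xI p' => pos_drop m' p'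
  | _, _ => p
  end.

Lemma enc_pos_take m p : enc_pos (pos_take m p) = pos_prefix m p ++ [:: false].
Proof. by elim: m p => [|m IH] [p|p|] //=; rewrite IH. Qed.

Lemma pos_prefixD m1 m2 p :
  pos_prefix (m1 + m2) p = pos_prefix m1 p ++ pos_prefix m2 (pos_drop m1 p).
Proof. by elim: m1 p => [|m IH] [p|p|] //=; rewrite ?IH //; case: (m2). Qed.

Lemma enc_nat_trunc m b :
  enc_nat (trunc m b) =
  if N.of_nat b is Npos p then true :: pos_prefix m p ++ [:: false] else [:: false].
Proof.
rewrite /trunc; case: (N.of_nat b) => // p.
by rewrite /enc_nat (Nnat.N2Nat.id (Npos _)) /= enc_pos_take.
Qed.

(** * Execution of the kernelization program *)

Section Main.
Variable x : seq bool.
Local Notation exec := (exec x).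

Definition St a q b t f c g : heads := [:: a; q; b; t; f; c; g].

Lemma exec_copy a q b t f c g : a <= size x ->
  exec (copy 0 2 3) (St a q b t f c g) (St a q a 0 f c g) [::].
Proof.
move=> le; apply: exec_nil (@exec_zero x (St a q b t f c g) 2 isT) _.
apply: exec_nil (@exec_zero x (St a q 0 t f c g) 3 isT) _.
have up k : forall a', a' + k <= size x ->
  exec (CWhile (TPos 0) (CL 0;; CR 3;; CR 2)) (St a' q k k f c g) (St 0 q (a' + k) (a' + k) f c g) [::].
  move=> a'; elim: a' k => [|a' IH] k lek; first exact: exec_whileF.
  rewrite -[[::]]cat0s addSnnS; apply: exec_whileT (IH k.+1 _) => //; last by rewrite -addSnnS.
  have lt : k < size x by lia.
  apply: exec_nil (exec_L _ _ 0) _.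
  by apply: exec_nil (@exec_R _ (St a' q k k f c g) 3 lt) (@exec_R _ (St a' q k k.+1 f c g) 2 lt).
have down k : forall a', a' + k <= size x ->
  exec (CWhile (TPos 3) (CL 3;; CR 0)) (St a' q a k f c g) (St (a' + k) q a 0 f c g) [::].
  elim: k => [|k IH] a' lek; first by rewrite addn0; apply: exec_whileF.
  rewrite -[[::]]cat0s -addSnnS; apply: exec_whileT (IH a'.+1 _) => //; last by rewrite addSnnS.
  have lt : a' < size x by lia.
  by apply: exec_nil (@exec_L x (St a' q a k.+1 f c g) 3) (@exec_R _ (St a' q a k f c g) 0 lt).
have := up 0 a; rewrite addn0 => /(_ le) U.
by apply: exec_nil U (down a 0 le).
Qed.

(** Only head 1 must end behind its number; head 2 is a disposable copy, and its final position is
    left open. *)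
Lemma exec_lt_int a q b t f c g w v r1 r2 :
  drop q x = enc_int w ++ r1 -> drop b x = enc_int v ++ r2 ->
  exists b', exec lt_int (St a q b t f c g) (St a (q + size (enc_int w)) b' t f c (w < v)%R) [::].
Proof.
move=> ew ev.
have [lq nq _] : [/\ q < size x, nth false x q = (if w is Posz _ then false else true) & true].
  by case: w ew => n /drop_consP[].
have [lb nb _] : [/\ b < size x, nth false x b = (if v is Posz _ then false else true) & true].
  by case: v ev => n /drop_consP[].
have x0 : 0 < size x by apply: leq_ltn_trans lq.
have R1 : exec (CR 1) (St a q b t f c g) (St a q.+1 b t f c g) [::] by apply: (@exec_R _ _ 1).
have R2 : exec (CR 2) (St a q.+1 b t f c g) (St a q.+1 b.+1 t f c g) [::] by apply: (@exec_R _ _ 2).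
case: w ew nq => n ew nq; case: v ev nb => m ev nb.
- have [_ _ ew1] := drop_consP ew; have [_ _ ev1] := drop_consP ev.
  eexists; apply: exec_ifF; first by rewrite /= nq.
  apply: exec_ifF; first by rewrite /= nb.
  apply: exec_nil R1 _; apply: exec_nil R2 _.
  rewrite /= -addSnnS ltz_nat -is_lt_nat.
  exact: (@exec_lt_N x 1 2 (fun u v g => St a u v t f c g)) ew1 ev1.
- exists b; apply: exec_ifF; first by rewrite /= nq.
  apply: exec_ifT; first by rewrite /= nb.
  apply: exec_nil (@exec_zero x (St a q b t f c g) 6 isT) _.
  exact: (@consumes_int x 1 n (St a q b t f c 0) _ isT ew).
- exists b; apply: exec_ifT; first by rewrite /= nq.
  apply: exec_ifF; first by rewrite /= nb.
  apply: exec_nil (@exec_set1 x (St a q b t f c g) 6 isT x0) _.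
  exact: (@consumes_int x 1 (Negz n) (St a q b t f c 1) _ isT ew).
- have [_ _ ew1] := drop_consP ew; have [_ _ ev1] := drop_consP ev.
  eexists; apply: exec_ifT; first by rewrite /= nq.
  apply: exec_ifT; first by rewrite /= nb.
  apply: exec_nil R1 _; apply: exec_nil R2 _.
  have -> : (Negz n < Negz m)%R = (m < n) by lia.
  rewrite /= -addSnnS -is_lt_nat.
  exact: (@exec_lt_N x 2 1 (fun u v g => St a v u t f c g)) ev1 ew1.
Qed.

Notation enc_ex := (enc_list enc_int).
Notation enc_exs := (enc_list (enc_list enc_int)).

Lemma drop_enc_cons (T : Type) (enc : T -> seq bool) y l q r :
  drop q x = enc_list enc (y :: l) ++ r -> drop q.+1 x = enc y ++ (enc_list enc l ++ r).
Proof. by rewrite /= -catA => /drop_consP[]. Qed.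

Lemma size_enc_list (T : Type) (enc : T -> seq bool) l : size l < size (enc_list enc l).
Proof. by elim: l => //= y l IH; rewrite size_cat; lia. Qed.

Lemma size_drop_le p w r : drop p x = w ++ r -> size w <= size x.
Proof. by move=> e; have := congr1 size e; rewrite size_drop size_cat; lia. Qed.

Lemma exec_skip_values a b t g e r : forall f q c, f <= size e -> c + f <= size x ->
  drop q x = enc_ex e ++ r ->
  exists q', drop q' x = enc_ex (drop f e) ++ r /\
    exec (CWhile (TPos 4) (CL 4;; CR 5;; CR 1;; skip_int 1))
       (St a q b t f c g) (St a q' b t 0 (c + f) g) [::].
Proof.
elim: e => [|v e IH] [|f] q c //.
- by move=> _ _ eq; exists q; rewrite addn0; split=> //; apply: exec_whileF.
- by move=> _ _ eq; exists q; rewrite addn0; split=> //; apply: exec_whileF.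
rewrite ltnS => lf lc eq.
have [lq _ _] := drop_consP eq; have eq1 := drop_enc_cons eq.
have [|q' [eq' exec']] := IH f _ c.+1 lf _ (drop_catP eq1); first by rewrite addSnnS.
exists q'; split=> //; rewrite -[[::]]cat0s -addSnnS; apply: exec_whileT exec' => //.
apply: exec_nil (exec_L _ _ 4) _.
have lt : c < size x by lia.
apply: exec_nil (@exec_R _ (St a q b t f c g) 5 lt) _.
apply: exec_nil (@exec_R _ (St a q b t f c.+1 g) 1 lq) _.
exact: (@consumes_int x 1 v (St a q.+1 b t f c.+1 g) _ isT eq1).
Qed.

Lemma exec_restore a q b t g c : forall f, f + c <= size x ->
  exec (CWhile (TPos 5) (CL 5;; CR 4)) (St a q b t f c g) (St a q b t (f + c) 0 g) [::].
Proof.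
elim: c => [|c IH] f le; first by rewrite addn0; apply: exec_whileF.
rewrite -[[::]]cat0s -addSnnS; apply: exec_whileT (IH f.+1 _) => //; last by rewrite addSnnS.
have lt : f < size x by lia.
by apply: exec_nil (@exec_L x (St a q b t f c.+1 g) 5) (@exec_R _ (St a q b t f c g) 4 lt).
Qed.

Definition row_out f v (e : seq int) : seq bool :=
  if (exval e f < v)%R then [:: true; false] else [::].

Lemma exec_compare_row a q b t f g e v r r' : f < size e ->
  drop q x = enc_ex e ++ r -> drop a x = enc_int v ++ r' ->
  exists q' b' t' g', drop q' x = r /\
    exec compare_row (St a q b t f 0 g) (St a q' b' t' f 0 g') (row_out f v e).
Proof.
move=> lf eq ea.
(* A head can hold a feature index because an encoded example is longer than its number of
   features. *)
have lx : f <= size x.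
  by have := size_drop_le eq; have := size_enc_list enc_int e; lia.
have la : a <= size x.
  by case: (v) ea => n /drop_consP[] /ltnW.
have [q1 [eq1 ex1]] := @exec_skip_values a b t g e r f q 0 (ltnW lf) lx eq.
have ex2 := @exec_restore a q1 b t g f 0 lx; rewrite !add0n in ex1 ex2.
rewrite (drop_nth 0%R lf) in eq1.
have [lq1 _ _] := drop_consP eq1; have eq2 := drop_enc_cons eq1.
have [b' ex3] := @exec_lt_int a q1.+1 a 0 f 0 g _ _ _ _ eq2 ea.
have eq3 := drop_catP eq2.
exists (q1.+1 + size (enc_int (exval e f)) + size (enc_ex (drop f.+1 e))), b', 0.
exists (exval e f < v)%R; split; first exact: drop_catP eq3.
apply: exec_nil ex1 _; apply: exec_nil ex2 _.
apply: exec_nil (@exec_R _ (St a q1 b t f 0 g) 1 lq1) _.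
apply: exec_nil (exec_copy q1.+1 b t f 0 g la) _; apply: exec_nil ex3 _.
rewrite /row_out; case: (_ < _)%R.
  rewrite -[[:: true; false]]cats0; apply: exec_seq.
    by apply: exec_ifT => //; exact: (exec_seq (exec_out _ _ _) (exec_out _ _ _)).
  exact: (@consumes_ex x 1 _ (St a _ b' 0 f 0 1) _ isT eq3).
rewrite -[[::]]cats0; apply: exec_seq; first by apply: exec_ifF => //; exact: exec_skip.
exact: (@consumes_ex x 1 _ (St a _ b' 0 f 0 0) _ isT eq3).
Qed.

Lemma exec_compare_rows a f v r r' l : forall q b t g, all (fun e => f < size e) l ->
  drop q x = enc_exs l ++ r -> drop a x = enc_int v ++ r' ->
  exists q' b' t' g', drop q' x = r /\
    exec (walk_list 1 compare_row (CR 1)) (St a q b t f 0 g) (St a q' b' t' f 0 g')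
       (flatten (map (row_out f v) l)).
Proof.
elim: l => [|e l IH] q b t g.
  move=> _ eq ea; have [lq nq eq1] := drop_consP eq.
  exists q.+1, b, t, g; split=> //; apply: exec_exit; first by rewrite /= nq.
  exact: (@exec_R _ (St a q b t f 0 g) 1 lq).
case/andP=> le al eq ea; have [lq nq _] := drop_consP eq; have eq1 := drop_enc_cons eq.
have [q1 [b1 [t1 [g1 [eq2 ex1]]]]] := @exec_compare_row a q.+1 b t f g e v _ r' le eq1 ea.
have [q' [b' [t' [g' [eq' exec']]]]] := IH q1 b1 t1 g1 al eq2 ea.
exists q', b', t', g'; split=> //; apply: exec_unroll exec'; first by rewrite /= nq.
exact: exec_nil (@exec_R _ (St a q b t f 0 g) 1 lq) ex1.
Qed.

Variables (nf : nat) (P N : seq (seq int)) (r0 : seq bool).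
Hypothesis x_def : x = enc_nat nf ++ enc_exs P ++ enc_exs N ++ r0.
Hypothesis size_P : all (fun e => size e == nf) P.
Hypothesis size_N : all (fun e => size e == nf) N.

Lemma exec_rewind a q b t f c g : exists2 q', drop q' x = enc_exs P ++ enc_exs N ++ r0 &
  exec (zero 1;; skip_N 1) (St a q b t f c g) (St a q' b t f c g) [::].
Proof.
have e0 : drop 0 x = enc_nat nf ++ (enc_exs P ++ enc_exs N ++ r0) by rewrite drop0.
exists (0 + size (enc_nat nf)); first exact: drop_catP e0.
apply: exec_nil (@exec_zero x (St a q b t f c g) 1 isT) _.
exact: (@consumes_skip_N x 1 _ (St a 0 b t f c g) _ isT e0).
Qed.

Lemma exec_seqA c1 c2 c3 s s' o : exec ((c1;; c2);; c3) s s' o -> exec (c1;; c2;; c3) s s' o.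
Proof.
case/exec_seq_inv=> s2 [o12 [o3 [/exec_seq_inv[s1 [o1 [o2 [h1 h2 ->]]]] h3 ->]]].
by rewrite -catA; apply: exec_seq h1 (exec_seq h2 h3).
Qed.

Lemma exec_emit_value a q b t f g v r : f < nf -> drop a x = enc_int v ++ r ->
  exists q' b' t' g',
    exec emit_value (St a q b t f 0 g) (St a q' b' t' f 0 g')
       (enc_int (Posz (2 ^ rank (P ++ N) f v))).
Proof.
move=> lf ea.
have sub (l : seq (seq int)) : all (fun e => size e == nf) l -> all (fun e => f < size e) l.
  by apply: sub_all => e /eqP ->.
have [q1 eq1 ex1] := exec_rewind a q b t f 0 g.
have [q2 [b2 [t2 [g2 [eq2 ex2]]]]] := exec_compare_rows b t g (sub _ size_P) eq1 ea.
have [q3 [b3 [t3 [g3 [eq3 ex3]]]]] := exec_compare_rows b2 t2 g2 (sub _ size_N) eq2 ea.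
exists q3, b3, t3, g3; rewrite /rank enc_int_pow_count.
rewrite map_cat flatten_cat -/(row_out f v).
apply: (exec_cat (exec_out _ _ false)) (erefl _); apply: (exec_cat (exec_out _ _ true)) (erefl _).
apply: exec_seqA; apply: exec_nil ex1 _; rewrite -catA.
by apply: exec_seq ex2 _; apply: exec_seq ex3 _; apply: exec_out.
Qed.

Local Notation l := (P ++ N).

Lemma exec_emit_values r e : forall a q b t f g, nf < size x -> f + size e = nf ->
  drop a x = enc_ex e ++ r ->
  exists a' q' b' t' f' g', drop a' x = r /\
    exec (walk_list 0 (emit_value;; skip_int 0;; CR 4) (echo 0))
       (St a q b t f 0 g) (St a' q' b' t' f' 0 g') (enc_ex (compress_from l f e)).
Proof.
elim: e => [|v e IH] a q b t f g lx sz ea; have [la na _] := drop_consP ea.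
  exists a.+1, q, b, t, f, g; split; first by have [] := drop_consP ea.
  apply: exec_exit; first by rewrite /= na.
  by have := @consumes_echo x 0 false (St a q b t f 0 g) _ isT ea; rewrite [hset _ _ _]/= addn1.
have ea1 := drop_enc_cons ea.
have lf : f < nf by move: sz => /=; lia.
have [q1 [b1 [t1 [g1 ex1]]]] := exec_emit_value q b t g lf ea1.
have [|a' [q' [b' [t' [f' [g' [ea' exec']]]]]]] := IH _ q1 b1 t1 f.+1 g1 lx _ (drop_catP ea1).
  by rewrite addSnnS.
exists a', q', b', t', f', g'; split=> //.
rewrite -[enc_list _ _]/((true :: enc_int (Posz (2 ^ rank l f v))) ++
  enc_ex (compress_from l f.+1 e)).
apply: exec_unroll exec'; first by rewrite /= na.
have E := @consumes_echo x 0 true (St a q b t f 0 g) _ isT ea; rewrite [hset _ _ _]/= addn1 in E.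
apply: (exec_cat E) (erefl _); apply: (exec_cat (o2 := [::]) ex1); last by rewrite cats0.
apply: exec_nil (@consumes_int x 0 v (St a.+1 q1 b1 t1 f 0 g1) _ isT ea1) _.
by apply: (@exec_R _ (St _ q1 b1 t1 f 0 g1) 4); apply: ltn_trans lx.
Qed.

Lemma exec_emit_examples r es : forall a q b t f g, all (fun e => size e == nf) es ->
  drop a x = enc_exs es ++ r ->
  exists a' q' b' t' f' g', drop a' x = r /\
    exec (walk_list 0 emit_example (echo 0))
       (St a q b t f 0 g) (St a' q' b' t' f' 0 g') (enc_exs (map (compress l) es)).
Proof.
elim: es => [|e es IH] a q b t f g al ea; have [la na _] := drop_consP ea.
  exists a.+1, q, b, t, f, g; split; first by have [] := drop_consP ea.
  apply: exec_exit; first by rewrite /= na.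
  by have := @consumes_echo x 0 false (St a q b t f 0 g) _ isT ea; rewrite [hset _ _ _]/= addn1.
case/andP: al => /eqP sz al; have ea1 := drop_enc_cons ea.
have lx : nf < size x.
  by rewrite -sz; apply: leq_trans (size_enc_list enc_int e) (size_drop_le ea1).
have [a1 [q1 [b1 [t1 [f1 [g1 [ea2 ex1]]]]]]] := @exec_emit_values _ e a.+1 q b t 0 g lx sz ea1.
have [a' [q' [b' [t' [f' [g' [ea' exec']]]]]]] := IH _ q1 b1 t1 f1 g1 al ea2.
exists a', q', b', t', f', g'; split=> //.
rewrite -[enc_list _ _]/((true :: enc_ex (compress l e)) ++ enc_exs (map (compress l) es)).
apply: exec_unroll exec'; first by rewrite /= na.
have E := @consumes_echo x 0 true (St a q b t f 0 g) _ isT ea; rewrite [hset _ _ _]/= addn1 in E.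
apply: (exec_cat E) (erefl _).
by apply: exec_nil (@exec_zero x (St a.+1 q b t f 0 g) 4 isT) ex1.
Qed.

Lemma exec_emit_digits b t f c g r r' es : forall a q p,
  drop a x = enc_pos p ++ r' -> drop q x = enc_exs es ++ r ->
  exists a' q', [/\ drop a' x = enc_pos (pos_drop (size es) p) ++ r', drop q' x = r &
    exec (walk_list 1 (skip_ex 1;; CIf (TBit 0) (echo 0;; echo 0) CSkip) (CR 1))
       (St a q b t f c g) (St a' q' b t f c g) (pos_prefix (size es) p)].
Proof.
elim: es => [|e es IH] a q p ea eq; have [lq nq _] := drop_consP eq.
  exists a, q.+1; split; [by [] | by have [] := drop_consP eq |].
  apply: exec_exit; first by rewrite /= nq.
  exact: (@exec_R _ (St a q b t f c g) 1 lq).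
have eq1 := drop_enc_cons eq; have eq2 := drop_catP eq1.
have S1 : exec (CR 1;; skip_ex 1) (St a q b t f c g)
     (St a (q.+1 + size (enc_ex e)) b t f c g) [::].
  apply: exec_nil (@exec_R _ (St a q b t f c g) 1 lq) _.
  exact: (@consumes_ex x 1 e (St a q.+1 b t f c g) _ isT eq1).
have D v p' : drop a x = [:: true, v & enc_pos p'] ++ r' ->
   exists a' q', [/\ drop a' x = enc_pos (pos_drop (size es) p') ++ r', drop q' x = r &
    exec (walk_list 1 (skip_ex 1;; CIf (TBit 0) (echo 0;; echo 0) CSkip) (CR 1))
       (St a q b t f c g) (St a' q' b t f c g) [:: true, v & pos_prefix (size es) p']].
  move=> e1; have [a' [q' [ea' eq' exec']]] := IH _ _ p' (@drop2 x _ _ _ _ e1) eq2.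
  exists a', q'; split=> //; rewrite -[_ :: _]/([:: true; v] ++ _).
  apply: exec_unroll exec'; first by rewrite /= nq.
  apply: exec_seqA; apply: exec_nil S1 _.
  apply: exec_ifT; first by have [_ na _] := drop_consP e1; rewrite /= na.
  have [_ _ e2] := drop_consP e1.
  have E1 := @consumes_echo x 0 true (St a _ b t f c g) _ isT e1.
  have E2 := @consumes_echo x 0 v (St a.+1 _ b t f c g) _ isT e2.
  have := exec_seq (E1 (q.+1 + size (enc_ex e))); rewrite [hset _ _ _]/= addn1 => H.
  by have := H _ _ _ (E2 _); rewrite [hset _ _ _]/= addn1.
case: p ea => [p|p|] ea; [exact: D ea | exact: D ea |].
(* The digits are used up: head 0 waits on the closing bit and the remaining examples add
   nothing. *)
have [a' [q' [ea' eq' exec']]] := IH _ _ xH ea eq2.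
have z k : pos_drop k xH = xH by case: k.
have z' k : pos_prefix k xH = [::] by case: k.
rewrite z in ea'; rewrite z' in exec'.
exists a', q'; split=> //; rewrite z' -[[::]]cat0s.
apply: exec_unroll exec'; first by rewrite /= nq.
apply: exec_seqA; apply: exec_nil S1 _.
apply: exec_ifF; last exact: exec_skip.
by have [_ na _] := drop_consP ea; rewrite /= na.
Qed.

Lemma exec_emit_budget a q b t f c g k : drop a x = enc_nat k ->
  exists s', exec emit_budget (St a q b t f c g) s' (enc_nat (trunc (size l) k)).
Proof.
rewrite -[enc_nat k]cats0 enc_nat_trunc /enc_nat; case: (N.of_nat k) => [|p] ea.
  eexists; apply: exec_ifF; last exact: exec_out.
  by have [_ na _] := drop_consP ea; rewrite /= na.
have [la na ea1] := drop_consP ea.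
have [q1 eq1 ex1] := exec_rewind a.+1 q b t f c g.
have [a2 [q2 [ea2 eq2 ex2]]] := exec_emit_digits b t f c g ea1 eq1.
have [a3 [q3 [ea3 eq3 ex3]]] := exec_emit_digits b t f c g ea2 eq2.
exists (St a3 q3 b t f c g); apply: exec_ifT; first by rewrite /= na.
have E := @consumes_echo x 0 true (St a q b t f c g) _ isT ea; rewrite [hset _ _ _]/= addn1 in E.
apply: (exec_cat E) (erefl _); apply: exec_seqA; apply: exec_nil ex1 _.
rewrite size_cat pos_prefixD -catA.
by apply: exec_seq ex2 _; apply: exec_seq ex3 _; apply: exec_out.
Qed.

End Main.

Lemma exec_kernel I : CI_wf (inst_ci I) ->
  exists s', exec (enc_inst I) kernel_cmd (nseq nheads 0) s' (enc_inst (kernel I)).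
Proof.
case/and4P; rewrite all_cat => /andP[szP szN] _ _ _.
set x := enc_inst I; set nf := nfeat _ in szP szN.
set P := pos _ in szP *; set N := neg _ in szN *.
have x_def : x = enc_nat nf ++ enc_list (enc_list enc_int) P ++
    enc_list (enc_list enc_int) N ++ enc_nat (budget I) by [].
clearbody x.
have e0 : drop 0 x = enc_nat nf ++ (enc_list (enc_list enc_int) P ++
    enc_list (enc_list enc_int) N ++ enc_nat (budget I)).
  by rewrite drop0.
have e1 := drop_catP e0.
have S1 := @consumes_skip_N x 0 _ (nseq nheads 0) _ isT e0.
have triv s : exists s', exec x emit_trivial s s' [:: false; false; false; false].
  exists s; rewrite /emit_trivial
    -[[:: false; false; false; false]]/([:: false] ++ [:: false] ++ [:: false] ++ [:: false]).
  by do 3 (apply: exec_seq; first exact: exec_out); apply: exec_out.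
rewrite /kernel -/P -/N.
case EP: P e1 => [|e P'] e1.
  have [s' h] := triv (hset (nseq nheads 0) 0 (hget (nseq nheads 0) 0 + size (enc_nat nf))).
  exists s'; apply: exec_nil S1 _; apply: exec_ifF => //.
  by have [_ nx _] := drop_consP e1; rewrite /= nx.
rewrite -EP in e1 *; have -> /= : (P == [::]) = false by rewrite EP.
have e2 := drop_catP e1.
have S2 := @consumes_exs x 0 P (hset (nseq nheads 0) 0 (0 + size (enc_nat nf))) _ isT e1.
have hP s : hget s 0 = 0 + size (enc_nat nf) -> holds x (TBit 0) s.
  move=> /= ->; rewrite EP in e1; have [_ nx _] := drop_consP e1.
  by rewrite nx.
case EN: N e2 => [|e' N'] e2.
  have [s' h] := triv (hset (nseq nheads 0) 0
    (0 + size (enc_nat nf) + size (enc_list (enc_list enc_int) P))).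
  exists s'; apply: exec_nil S1 _; apply: exec_ifT; first exact: hP.
  apply: exec_nil S2 _; apply: exec_ifF => //.
  by have [_ nx _] := drop_consP e2; rewrite /= nx.
rewrite -EN in e2 *; have -> /= : (N == [::]) = false by rewrite EN.
have [a1 [q1 [b1 [t1 [f1 [g1 [e3 X1]]]]]]] :=
  @exec_emit_examples x nf P N _ x_def szP szN _ P _ 0 0 0 0 0 szP e1.
have [a2 [q2 [b2 [t2 [f2 [g2 [e4 X2]]]]]]] :=
  @exec_emit_examples x nf P N _ x_def szP szN _ N _ q1 b1 t1 f1 g1 szN e3.
have [s' X3] := @exec_emit_budget x nf P N _ x_def a2 q2 b2 t2 f2 0 g2 _ e4.
exists s'; apply: exec_nil S1 _; apply: exec_ifT; first exact: hP.
apply: exec_nil S2 _; apply: exec_ifT.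
  by rewrite EN in e2; have [_ nx _] := drop_consP e2; rewrite /= nx.
apply: exec_nil (@exec_zero x (St _ 0 0 0 0 0 0) 0 isT) _.
apply: exec_seq (@consumes_echo_N x 0 _ (St 0 0 0 0 0 0 0) _ isT e0) _.
by apply: exec_seq X1 _; apply: exec_seq X2 _.
Qed.

(** * The kernelization is correct and small *)

Lemma leq_count_in (T : eqType) (p q : pred T) (s : seq T) :
  {in s, forall z, p z -> q z} -> count p s <= count q s.
Proof.
move=> sub; rewrite (eq_in_count (a2 := predI p q)) ?sub_count // => [z /andP[]//|z zs].
by rewrite /=; case pz: (p z) => //=; rewrite (sub z zs pz).
Qed.

Lemma count_lt (T : eqType) (p q : pred T) (s : seq T) (y : T) :
  {in s, forall z, p z -> q z} -> y \in s -> q y -> ~~ p y -> count p s < count q s.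
Proof.
move=> sub ys qy py.
rewrite -[ltnRHS]size_filter -(count_predC p (filter q s)) !count_filter.
rewrite (eq_in_count (a1 := predI p q) (a2 := p)); last first.
  by move=> z zs /=; case pz: (p z) => //=; rewrite (sub z zs pz).
rewrite -[X in X < _]addn0 ltn_add2l -has_count; apply/hasP; exists y => //=.
by rewrite py.
Qed.

Section Rank.
Variables (l : seq (seq int)) (f : nat).

(** Strictness comes from [e] itself, which is counted below [v] but not below its own value. *)
Lemma rank_lt e v : e \in l -> (rank l f (exval e f) < rank l f v) = (exval e f < v)%R.
Proof.
move=> el; case: (ltP (exval e f) v) => h.
  apply: (@count_lt _ _ _ _ e) => //; last by rewrite ltxx.
  by move=> e' _ /lt_trans; apply.
apply/negbTE; rewrite -leqNgt; apply: leq_count_in => e' _ /lt_le_trans; exact.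
Qed.

End Rank.

Lemma size_compress l e : size (compress l e) = size e.
Proof. by rewrite /compress; elim: e 0 => //= v e IH f; rewrite IH. Qed.

Lemma exval_compress l e f : f < size e ->
  exval (compress l e) f = Posz (2 ^ rank l f (exval e f)).
Proof.
suff H g : f < size e -> nth 0%R (compress_from l g e) f = Posz (2 ^ rank l (g + f) (exval e f)).
  by move=> /(H 0); rewrite add0n.
rewrite /exval; elim: e f g => //= v e IH [|f] g lt /=; first by rewrite addn0.
by rewrite IH // addSnnS.
Qed.

Lemma compress_le l f e e' : e \in l -> e' \in l -> f < size e -> f < size e' ->
  (exval (compress l e) f <= exval (compress l e') f)%R = (exval e f <= exval e' f)%R.
Proof.
move=> el el' lt lt'; rewrite !exval_compress // lez_nat leq_exp2l //.
by rewrite leqNgt rank_lt // -leNgt.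
Qed.

Lemma compress_eq l f e e' : e \in l -> e' \in l -> f < size e -> f < size e' ->
  (exval (compress l e) f == exval (compress l e') f)%R = (exval e f == exval e' f)%R.
Proof. by move=> *; rewrite !eq_le !compress_le. Qed.

(** Keeps the classes free of duplicates and disjoint, as [CI_wf] demands of the kernel. *)
Lemma compress_inj l n : all (fun e => size e == n) l -> {in l &, injective (compress l)}.
Proof.
move=> al e e' el el' eq.
have /eqP sz := allP al _ el; have /eqP sz' := allP al _ el'.
apply: (@eq_from_nth _ 0%R) => [|f lt]; first by rewrite sz.
by apply/eqP; rewrite -/(exval e f) -/(exval e' f) -(compress_eq el el') ?eq // sz' -sz.
Qed.

(** * Decision trees under order-preserving changes of values *)

Section Transfer.
Variables (T0 : eqType) (s : seq T0).

Lemma seq_max (h : T0 -> int) (r : seq T0) : r = [::] \/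
  exists2 a, a \in r & {in r, forall b, (h b <= h a)%R}.
Proof.
elim: r => [|a r [->|[m mr mP]]]; [by left | |]; right.
  by exists a; rewrite ?inE // => b; rewrite inE => /eqP ->.
case: (leP (h a) (h m)) => le.
  by exists m => [|b]; rewrite ?inE ?mr ?orbT // => /orP[/eqP ->|/mP].
exists a => [|b]; rewrite ?inE ?eqxx // => /orP[/eqP -> //|/mP le'].
exact: le_trans le' (ltW le).
Qed.

Lemma seq_lower_bound (h : T0 -> int) : exists t, {in s, forall a, (t < h a)%R}.
Proof.
case: (seq_max (fun a => - h a)%R s) => [->|[m _ mP]]; first by exists 0%R.
exists (h m - 1)%R => a /mP; lia.
Qed.

(** The new threshold is the largest new value among the elements sent left, or lies below all new
    values if there are none. *)
Lemma threshold_transfer (g h : T0 -> int) t :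
  {in s &, forall a b, (g a <= g b)%R = (h a <= h b)%R} ->
  exists t', {in s, forall a, (h a <= t')%R = (g a <= t)%R}.
Proof.
move=> gh; case: (seq_max h [seq a <- s | (g a <= t)%R]) => [none|[m]].
  have [t' t'P] := seq_lower_bound h; exists t' => a as_.
  rewrite leNgt t'P //; apply/esym/negbTE/negP => le.
  have : a \in [seq a <- s | (g a <= t)%R] by rewrite mem_filter le.
  by rewrite none.
rewrite mem_filter => /andP[mt ms] mP; exists (h m) => a as_.
apply/idP/idP => le; last by apply: mP; rewrite mem_filter le.
by apply: le_trans mt; rewrite gh.
Qed.

(** Two maps [phi] and [psi] from a common index set allow one proof for both directions between an
    instance and its kernel. *)
Lemma dt_transfer n (phi psi : T0 -> seq int) (T : DT) :
  (forall f, f < n -> {in s &, forall a b,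
     (exval (phi a) f <= exval (phi b) f)%R = (exval (psi a) f <= exval (psi b) f)%R}) ->
  dt_features_ok n T ->
  exists T', [/\ dt_features_ok n T', dt_size T' = dt_size T, dt_depth T' = dt_depth T &
    {in s, forall a, dt_classify T' (psi a) = dt_classify T (phi a)}].
Proof.
move=> mono; elim: T => [b|f t L IHL R IHR] /=; first by exists (Leaf b).
case/and3P=> lf /IHL[L' [okL szL dL cL]] /IHR[R' [okR szR dR cR]].
have [t' t'P] := threshold_transfer t (mono f lf).
exists (Node f t' L' R'); split=> /=; rewrite ?lf ?okL ?okR ?szL ?szR ?dL ?dR //.
by move=> a as_; rewrite t'P // cL // cR.
Qed.

End Transfer.

Lemma dt_depth_size T : dt_depth T <= dt_size T.
Proof. by elim: T => //= f t L IHL R IHR; lia. Qed.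

(** As long as both classes are present, some test has examples on both of its sides; by induction
    the tests number at most one less than the examples. *)
Lemma separating_tree (n : nat) (P N : seq (seq int)) :
  all (fun e => size e == n) (P ++ N) -> all (fun e => e \notin N) P ->
  exists T, [/\ dt_features_ok n T, all (dt_classify T) P,
    all (fun e => ~~ dt_classify T e) N & dt_size T <= (size P + size N).-1].
Proof.
have [k] := ubnP (size P + size N); elim: k P N => // k IH P N.
case: P => [|p P']; first by exists (Leaf false); split=> //; apply/allP.
case: N => [|e N']; first by exists (Leaf true); split=> //; apply/allP.
set P := p :: P'; set N := e :: N'; rewrite ltnS => le sz dj.
have pP : p \in P by rewrite inE eqxx.
have eN : e \in N by rewrite inE eqxx.
have /eqP szp : size p == n by apply: (allP sz); rewrite mem_cat pP.
have /eqP sze : size e == n by apply: (allP sz); rewrite mem_cat eN orbT.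
have [f lf ne] : exists2 f, f < n & exval p f != exval e f.
  have [/hasP[f fn ne]|no] := boolP (has (fun f => exval p f != exval e f) (iota 0 n)).
    by exists f => //; rewrite mem_iota in fn.
  have pe : p = e.
    apply: (@eq_from_nth _ 0%R); first by rewrite szp.
    move=> f lf; apply/eqP; move/hasPn: no => /(_ f); rewrite negbK; apply.
    by rewrite mem_iota -szp.
  by have := allP dj _ pP; rewrite pe eN.
(* The smaller of the two values sends [p] and [e] to different sides. *)
pose t := if (exval p f < exval e f)%R then exval p f else exval e f.
pose lo := fun e : seq int => (exval e f <= t)%R.
have szf (a : pred (seq int)) (s : seq (seq int)) :
    size (filter a s) + size (filter (predC a) s) = size s.
  by rewrite !size_filter count_predC.
have sub (a : pred (seq int)) : all (fun e => size e == n) (filter a P ++ filter a N) /\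
     all (fun e => e \notin filter a N) (filter a P).
  split; apply/allP => z.
    rewrite mem_cat !mem_filter => zP; apply: (allP sz); rewrite mem_cat.
    by case/orP: zP => /andP[_ ->]; rewrite ?orbT.
  rewrite !mem_filter => /andP[-> zP]; exact: (allP dj).
have gt0 (a : pred (seq int)) z (s : seq (seq int)) : z \in s -> a z -> 0 < size (filter a s).
  by move=> zs az; rewrite size_filter -has_count; apply/hasP; exists z.
have szP := szf lo P; have szN := szf lo N.
have pos1 : 0 < size (filter lo P) + size (filter lo N).
  rewrite addn_gt0; move: (gt0 lo p P pP) (gt0 lo e N eN); rewrite /lo /t.
  by case: ifP => h; [move=> /(_ (lexx _)) -> | move=> _ /(_ (lexx _)) ->; rewrite orbT].
have pos2 : 0 < size (filter (predC lo) P) + size (filter (predC lo) N).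
  have [hp|he] : predC lo p \/ predC lo e.
    rewrite /= /lo /t; case: (ltgtP (exval p f) (exval e f)) ne => // h _; [right|left].
      by rewrite -ltNge.
    by rewrite -ltNge.
  - by rewrite addn_gt0 (gt0 _ _ _ pP hp).
  - by rewrite addn_gt0 (gt0 _ _ _ eN he) orbT.
have [sz1 dj1] := sub lo; have [sz2 dj2] := sub (predC lo).
have [|T1 [ok1 p1 n1 s1]] := IH _ _ _ sz1 dj1; first by clear - le szP szN pos1 pos2; lia.
have [|T2 [ok2 p2 n2 s2]] := IH _ _ _ sz2 dj2; first by clear - le szP szN pos1 pos2; lia.
have szT : (dt_size T1 + dt_size T2).+1 <= (size P + size N).-1.
  by clear - s1 s2 szP szN pos1 pos2; lia.
exists (Node f t T1 T2); split=> //=.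
- by rewrite lf ok1 ok2.
- apply/(@allP _ _ P) => z zP /=; rewrite -/(lo z); case: ifP => lz.
    by apply: (allP p1); rewrite mem_filter lz.
  by apply: (allP p2); rewrite mem_filter /= lz.
- apply/(@allP _ _ N) => z zN /=; rewrite -/(lo z); case: ifP => lz.
    by apply: (allP n1); rewrite mem_filter lz.
  by apply: (allP n2); rewrite mem_filter /= lz.
Qed.

(** If something is cut, both numbers have at least m digits below the leading 1, and 2^m > m. *)
Lemma trunc_cases m b : trunc m b = b \/ (m <= b /\ m <= trunc m b).
Proof.
have H p : pos_take m p = p \/ (m < Pos.to_nat p /\ m < Pos.to_nat (pos_take m p)).
  elim: m p => [|m IH] [p|p|] /=; try by [left | right; lia].
    by case: (IH p) => [->|[h1 h2]]; [left | right; lia].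
  by case: (IH p) => [->|[h1 h2]]; [left | right; lia].
rewrite /trunc; case E: (N.of_nat b) => [|p]; first by left; lia.
have -> : b = Pos.to_nat p by lia.
by case: (H p) => [->|[h1 h2]]; [left | right; split; apply: ltnW].
Qed.

Lemma lambdaC E e e' : lambda E e e' = lambda E e' e.
Proof. by apply: eq_filter => f; rewrite eq_sym. Qed.

(** * Counting the examples close to a fixed one *)

Section Ball.
Variables (n D : nat) (V : nat -> seq int).
Hypothesis size_V : forall f, f < n -> size (V f) <= D.

(** [None] changes nothing, so that exactly c edits cover every distance up to c; it is the + 1 in
    the base of the bound. *)
Let edits : seq (option (nat * int)) :=
  None :: [seq Some (f, v) | f <- iota 0 n, v <- V f].

Let edit (o : option (nat * int)) (e : seq int) : seq int :=
  if o is Some (f, v) then set_nth 0%R e f v else e.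

Fixpoint ball (c : nat) (e : seq int) : seq (seq int) :=
  if c is c'.+1 then flatten [seq ball c' (edit o e) | o <- edits] else [:: e].

Lemma size_edits : size edits <= n * D + 1.
Proof.
rewrite addn1 /= ltnS size_allpairs_dep.
have H : forall s : seq nat, all (fun f => size (V f) <= D) s ->
    sumn [seq size (V f) | f <- s] <= size s * D.
  by elim=> //= f s IH /andP[h /IH h']; rewrite mulSn leq_add.
rewrite -[leqRHS](congr1 (muln^~ D) (size_iota 0 n)) H //.
by apply/allP => f; rewrite mem_iota => /size_V.
Qed.

Lemma size_ball c e : size (ball c e) <= (n * D + 1) ^ c.
Proof.
elim: c e => //= c IH e; rewrite expnS.
rewrite -[size _]/(size (flatten [seq ball c (edit o e) | o <- edits])).
apply: leq_trans (leq_mul size_edits (leqnn _)).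
elim: edits => //= o s IHs; rewrite size_cat mulSn; exact: leq_add.
Qed.

(** Each edit copies from [e] one coordinate in which the two sequences still differ. *)
Lemma mem_ball (c : nat) (e e0 : seq int) : size e = n -> size e0 = n ->
  (forall f, f < n -> exval e f \in V f) ->
  count (fun f => exval e f != exval e0 f) (iota 0 n) <= c -> e \in ball c e0.
Proof.
move=> sz + eV; elim: c e0 => [|c IH] e0 sz0 cnt.
  rewrite inE; apply/eqP/(@eq_from_nth _ 0%R) => [|f lf]; first by rewrite sz.
  apply/eqP; move: cnt; rewrite leqNgt -has_count => /hasPn/(_ f); rewrite negbK; apply.
  by rewrite mem_iota -sz.
apply/flattenP.
have [/hasP[f fn ne]|no] := boolP (has (fun f => exval e f != exval e0 f) (iota 0 n)); last first.
  exists (ball c e0); first by apply/mapP; exists None; rewrite ?inE.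
  by apply: IH => //; move: no; rewrite has_count -leqNgt leqn0 => /eqP ->.
have lf : f < n by rewrite mem_iota in fn.
exists (ball c (set_nth 0%R e0 f (exval e f))).
  apply/mapP; exists (Some (f, exval e f)) => //; rewrite inE; apply/orP; right.
  by apply/allpairsPdep; exists f, (exval e f); split=> //; apply: eV.
apply: IH; first by rewrite size_set_nth sz0 (maxn_idPr lf).
rewrite -ltnS; apply: leq_trans cnt; apply: (@count_lt _ _ _ _ f) => //.
  by move=> g _; rewrite /exval nth_set_nth /=; case: (eqVneq g f) => [->|_] //; rewrite eqxx.
by rewrite /exval nth_set_nth /= eqxx eqxx.
Qed.

End Ball.

Section Kernel.
Variables (c : nat) (E : CI).
Hypothesis wf : CI_wf E.
Hypothesis delta_le : delta_max E <= c.

Let n := nfeat E.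
Let l := pos E ++ neg E.

Lemma size_example e : e \in l -> size e = n.
Proof. by case/and4P: wf => /allP al _ _ _ /al/eqP. Qed.

Lemma class_size_bound (A : seq (seq int)) e0 : uniq A -> {subset A <= l} -> e0 \in l ->
  {in A, forall e, size (lambda E e e0) <= c} -> size A <= (n * D_max E + 1) ^ c.
Proof.
move=> uA sub e0l dl.
pose V f := undup [seq exval e f | e <- l].
have szV f : f < n -> size (V f) <= D_max E.
  by move=> lf; apply: (leq_bigmax (Ordinal lf)).
apply: leq_trans (size_ball szV c e0); apply: uniq_leq_size => // e eA.
apply: mem_ball.
- by apply: size_example; apply: sub.
- exact: size_example.
- by move=> f _; rewrite mem_undup; apply/mapP; exists e; rewrite ?sub.
- by rewrite -size_filter; apply: dl.
Qed.

Lemma lambda_le ep en : ep \in pos E -> en \in neg E -> size (lambda E ep en) <= c.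
Proof.
move=> pP pN; apply: leq_trans delta_le.
rewrite /delta_max.
have := @leq_bigmax_seq _ (pos E) xpredT
  (fun ep => \max_(en <- neg E) size (lambda E ep en)) ep pP isT.
by apply: leq_trans; apply: (@leq_bigmax_seq _ _ xpredT (fun en => size (lambda E ep en))).
Qed.

Lemma examples_bound : pos E != [::] -> neg E != [::] ->
  size l <= 2 * (n * D_max E + 1) ^ c.
Proof.
case/and4P: wf => _ uP uN _.
case EP: (pos E) => [|p P'] // _; case EN: (neg E) => [|e N'] // _.
have pP : p \in pos E by rewrite EP inE eqxx.
have eN : e \in neg E by rewrite EN inE eqxx.
rewrite /l size_cat mul2n -addnn; apply: leq_add.
  apply: (@class_size_bound _ e) => //; rewrite ?mem_cat ?eN ?orbT //.
    by move=> z zP; rewrite mem_cat zP.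
  by move=> z zP; apply: lambda_le.
apply: (@class_size_bound _ p) => //; rewrite ?mem_cat ?pP //.
  by move=> z zP; rewrite mem_cat zP orbT.
by move=> z zP; rewrite lambdaC; apply: lambda_le.
Qed.

Let E' := mkCI n (map (compress l) (pos E)) (map (compress l) (neg E)).

Lemma size_examples : all (fun e => size e == n) l.
Proof. by apply/allP => e /size_example ->. Qed.

Lemma pos_sub : {subset pos E <= l}. Proof. by move=> z zP; rewrite mem_cat zP. Qed.
Lemma neg_sub : {subset neg E <= l}. Proof. by move=> z zP; rewrite mem_cat zP orbT. Qed.

Lemma compress_wf : CI_wf E'.
Proof.
case/and4P: wf => _ uP uN dj; have inj := compress_inj size_examples.
apply/and4P; split=> /=.
- rewrite -map_cat all_map; apply/allP => e /size_example /= sz.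
  by rewrite size_compress sz.
- by rewrite map_inj_in_uniq // => a b /pos_sub al /pos_sub bl; apply: inj.
- by rewrite map_inj_in_uniq // => a b /neg_sub al /neg_sub bl; apply: inj.
- rewrite all_map; apply/allP => e eP /=; apply/negP => /mapP[e' eN /inj].
  move=> /(_ (pos_sub eP) (neg_sub eN)) ee; have := allP dj _ eP; by rewrite ee eN.
Qed.

Lemma lambda_compress e e' : e \in l -> e' \in l ->
  lambda E' (compress l e) (compress l e') = lambda E e e'.
Proof.
move=> el el'; apply: eq_in_filter => f; rewrite mem_iota /= => lf.
by rewrite compress_eq // size_example.
Qed.

Lemma compress_delta : delta_max E' <= c.
Proof.
rewrite /delta_max /= big_map; apply/bigmax_leqP_seq => ep eP _.
rewrite big_map; apply/bigmax_leqP_seq => en eN _.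
by rewrite lambda_compress ?(pos_sub eP) ?(neg_sub eN) //; apply: lambda_le.
Qed.

Lemma classifies_compress T : dt_classifies T E' =
  dt_features_ok n T && (all (fun e => dt_classify T (compress l e)) (pos E) &&
                         all (fun e => ~~ dt_classify T (compress l e)) (neg E)).
Proof. by rewrite /dt_classifies /= !all_map. Qed.

Lemma compress_mono f : f < n -> {in l &, forall a b,
  (exval a f <= exval b f)%R = (exval (compress l a) f <= exval (compress l b) f)%R}.
Proof. by move=> lf a b al bl; rewrite compress_le // size_example. Qed.

Lemma classifies_transfer T : dt_classifies T E ->
  exists T', [/\ dt_classifies T' E', dt_size T' = dt_size T & dt_depth T' = dt_depth T].
Proof.
case/and3P=> ok /allP cP /allP cN.
have [T' [ok' sz d cl]] := dt_transfer (phi := id) (psi := compress l) compress_mono ok.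
exists T'; split=> //; rewrite classifies_compress ok' /=; apply/andP; split; apply/allP => e eP /=.
  by rewrite cl ?pos_sub // cP.
by rewrite cl ?neg_sub // cN.
Qed.

Lemma classifies_transfer_back T : dt_classifies T E' ->
  exists T', [/\ dt_classifies T' E, dt_size T' = dt_size T & dt_depth T' = dt_depth T].
Proof.
rewrite classifies_compress => /and3P[ok /allP cP /allP cN].
have mono f : f < n -> {in l &, forall a b,
  (exval (compress l a) f <= exval (compress l b) f)%R = (exval a f <= exval b f)%R}.
  by move=> lf a b al bl; rewrite -compress_mono.
have [T' [ok' sz d cl]] := dt_transfer (phi := compress l) (psi := id) mono ok.
exists T'; split=> //; apply/and3P; split=> //; apply/allP => e eP /=.
  by have /= -> := cl _ (pos_sub eP); apply: cP.
by have /= -> := cl _ (neg_sub eP); apply: cN.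
Qed.

Lemma classifying_tree : exists T, dt_classifies T E /\ dt_size T <= size l.
Proof.
case/and4P: wf => sz _ _ dj; have [T [ok cP cN szT]] := separating_tree sz dj.
exists T; split; first by apply/and3P.
by rewrite size_cat; apply: leq_trans szT (leq_pred _).
Qed.

End Kernel.

(* The measure is the size for DTS and the depth for DTD. *)
Lemma kernel_equiv (mu : DT -> nat) c I : dom c I ->
  (forall b, mu (Leaf b) = 0) -> (forall T, mu T <= dt_size T) ->
  (forall T T', dt_size T' = dt_size T -> dt_depth T' = dt_depth T -> mu T' = mu T) ->
  (exists T, dt_classifies T (inst_ci I) /\ mu T <= budget I) <->
  (exists T, dt_classifies T (inst_ci (kernel I)) /\ mu T <= budget (kernel I)).
Proof.
case: I => E s [/= wf dl] mu0 mu_sz mu_eq; rewrite /kernel /=.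
have triv E0 : pos E0 = [::] \/ neg E0 = [::] -> forall k,
    exists T, dt_classifies T E0 /\ mu T <= k.
  case=> e k; [exists (Leaf false) | exists (Leaf true)]; rewrite mu0; split=> //.
    by rewrite /dt_classifies /= e /=; apply/allP.
  by rewrite /dt_classifies /= e /= andbT; apply/allP.
case: ifP => [|/norP[neP neN]] /=.
  move=> h; split=> _; apply: triv; first by left.
  by case/orP: h => /eqP; [left | right].
set l := _ ++ _.
have [T0 [cl0 sz0]] := classifying_tree wf.
have [T1 [cl1 sz1 d1]] := classifies_transfer wf cl0.
(* Either the budget is unchanged and trees are transferred, or both budgets admit the tree with at
   most [size l] tests. *)
case: (trunc_cases (size l) s) => [->|[h1 h2]].
  split=> -[T [cl le]].
    have [T' [cl' sz' d']] := classifies_transfer wf cl.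
    by exists T'; split=> //; rewrite (mu_eq T).
  have [T' [cl' sz' d']] := classifies_transfer_back wf cl.
  by exists T'; split=> //; rewrite (mu_eq T).
split=> _; [exists T1 | exists T0]; split=> //.
  by rewrite (mu_eq T0) //; apply: leq_trans (mu_sz _) (leq_trans sz0 h2).
by apply: leq_trans (mu_sz _) (leq_trans sz0 h1).
Qed.

Lemma kernel_dom c I : dom c I -> dom c (kernel I).
Proof.
move=> [wf dl]; rewrite /kernel; case: ifP => _.
  by split=> //=; rewrite /delta_max big_nil.
by split; [apply: compress_wf | apply: compress_delta].
Qed.

(** This crude linear bound suffices for the number of features, which is part of the parameter. *)
Lemma size_enc_nat k : size (enc_nat k) <= 2 * k + 1.
Proof.
rewrite /enc_nat; case E: (N.of_nat k) => [|p] /=; first by lia.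
have -> : k = Pos.to_nat p by lia.
by elim: p {E} => [p IH|p IH|] /=; lia.
Qed.

Lemma size_enc_list_le (T : eqType) (enc : T -> seq bool) (s : seq T) B :
  {in s, forall y, size (enc y) <= B} -> size (enc_list enc s) <= size s * B.+1 + 1.
Proof.
elim: s => //= y s IH h; rewrite size_cat.
have h1 : size (enc y) <= B by apply: h; rewrite inE eqxx.
have h2 : size (enc_list enc s) <= size s * B.+1 + 1.
  by apply: IH => z zs; apply: h; rewrite inE zs orbT.
by rewrite mulSn; lia.
Qed.

(** A value of rank r takes 2 r + 3 bits (sign, nonzero mark, r digits of two bits, end) and one
    more as a list element, with r at most [size l]. *)
Lemma size_enc_compress l e :
  size (enc_list enc_int (compress l e)) <= size e * (2 * size l + 4) + 1.
Proof.
rewrite -(size_compress l e); apply: leq_trans (size_enc_list_le (B := 2 * size l + 3) _) _.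
  move=> v /(nthP 0%R)[f]; rewrite size_compress => lf <-.
  rewrite -/(exval _ f) exval_compress //= enc_nat_pow2 /= size_cat /=.
  have -> : forall r, size (flatten (nseq r [:: true; false])) = 2 * r by elim=> //= r ->; lia.
  by have := count_size (fun e' => (exval e' f < exval e f)%R) l; rewrite /rank; lia.
by have -> : 2 * size l + 4 = (2 * size l + 3).+1 by lia.
Qed.

Lemma size_enc_trunc m b : size (enc_nat (trunc m b)) <= 2 * m + 2.
Proof.
rewrite enc_nat_trunc; case: (N.of_nat b) => [|p] //=; first by lia.
rewrite size_cat /=; have : size (pos_prefix m p) <= 2 * m; last by lia.
by elim: m p => [|m IH] [p|p|] //=; have := IH p; lia.
Qed.

Lemma leq_expn2r a b m : a <= b -> a ^ m <= b ^ m.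
Proof. by case: m => // m; rewrite leq_exp2r. Qed.

(** With k the parameter plus one, A = k^(2c+1) bounds the number of features and half the number of
    examples, because |F| D + 1 <= k^2. Examples, features per example and bits per value each
    contribute a factor linear in A, whence the exponent; 60 generously covers the coefficients. *)
Lemma kernel_size c I : dom c I ->
  size (enc_inst (kernel I)) <= 60 * (kparam I).+1 ^ (3 * (2 * c + 1)).
Proof.
case: I => E s [/= wf dl]; rewrite /kparam /=.
set k := (D_max E + nfeat E).+1; pose A := k ^ (2 * c + 1).
have A_gt0 : 0 < A by rewrite expn_gt0.
have -> : k ^ (3 * (2 * c + 1)) = A * (A * A) by rewrite mulnC expnM.
rewrite /kernel /=; case: ifP => [_|/norP[neP neN]].
  have h : 0 < A * (A * A) by rewrite !muln_gt0 A_gt0.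
  by rewrite /=; lia.
set l := pos E ++ neg E.
have szn : nfeat E <= A.
  by rewrite /A addn1 expnS; apply: leq_trans (leq_pmulr _ _); rewrite ?expn_gt0 // /k; lia.
have szl : size l <= 2 * A.
  apply: leq_trans (examples_bound wf dl neP neN) _; rewrite leq_mul2l /=.
  apply: (@leq_trans ((k * k) ^ c)); first by apply: leq_expn2r; rewrite /k; nia.
  by rewrite -{1 2}[k]expn1 -expnD -expnM leq_pexp2l //; lia.
have szc (es : seq (seq int)) : {subset es <= l} ->
    size (enc_list (enc_list enc_int) (map (compress l) es)) <=
    size es * (A * (4 * A + 4) + 2) + 1.
  move=> sub; rewrite -(size_map (compress l) es).
  have -> : A * (4 * A + 4) + 2 = (A * (4 * A + 4) + 1).+1 by lia.
  apply: size_enc_list_le.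
  move=> _ /mapP[e /sub el ->]; apply: leq_trans (size_enc_compress _ _) _.
  by rewrite leq_add2r (size_example wf) // leq_mul //; lia.
have h1 := szc _ (@pos_sub E); have h2 := szc _ (@neg_sub E).
have h3 := size_enc_nat (nfeat E); have h4 := size_enc_trunc (size l) s.
rewrite /enc_inst /= -/l !size_cat.
have szs : size (pos E) + size (neg E) <= 2 * A by rewrite -size_cat.
have h5 : (size (pos E) + size (neg E)) * (A * (4 * A + 4) + 2) <= 2 * A * (A * (4 * A + 4) + 2).
  by rewrite leq_mul2r szs orbT.
have AA : A <= A * (A * A) by apply: leq_pmulr; rewrite muln_gt0 A_gt0.
have A2 : A * A <= A * (A * A) by rewrite leq_mul2l; apply/orP; right; apply: leq_pmulr.
rewrite mulnDl in h5.
have e5 : 2 * A * (A * (4 * A + 4) + 2) = 8 * (A * (A * A)) + 8 * (A * A) + 4 * A by ring.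
rewrite e5 in h5.
rewrite -[X in trunc X _]size_cat -/l; lia.
Qed.

Lemma kernel_computable I : CI_wf (inst_ci I) ->
  tm_computes_within (cmd_TM kernel_cmd) (enc_inst I) (enc_inst (kernel I))
    (pointer_coef (compile kernel_cmd 0) * (size (enc_inst I)).+1 ^ 14).
Proof. by move=> /exec_kernel[s' h]; apply: cmd_TM_correct kernel_cmd_ok h. Qed.

(** One machine and one time bound serve both problems and every c; only the exponent of the size
    bound depends on c. *)
Lemma poly_kernel_of_equiv c (L : Inst -> Prop) :
  (forall I, dom c I -> L I <-> L (kernel I)) -> poly_kernel L (dom c) kparam.
Proof.
move=> equiv.
exists (cmd_TM kernel_cmd), (pointer_coef (compile kernel_cmd 0)), 14, 60, (3 * (2 * c + 1)).
move=> I dI; exists (kernel I); split.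
- exact: kernel_dom dI.
- exact: equiv dI.
- exact: kernel_size dI.
- exact: kernel_computable (proj1 dI).
Qed.

Theorem theorem3 (c : nat) :
  poly_kernel DTS (dom c) kparam /\ poly_kernel DTD (dom c) kparam.
Proof.
split; apply: poly_kernel_of_equiv => I dI; apply: kernel_equiv dI _ _ _ => //.
exact: dt_depth_size.
Qed.
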